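(* Let $n\ge1$, $\Delta\ge1$, and let $G_1=(V,E_1)$, $G_2=(V,E_2)$ be graphs on a common $n$-vertex set $V$, each of maximum degree at most $\Delta$; let $m=|E_1\cup E_2|$. Let $k\ge 5.948\Delta$ and let $L$ assign to each edge $e\in E_1\cup E_2$ a list $L(e)$ of $k$ positive integers. Then there is a $6$-local choice of flip probabilities $(P_i)_{i\ge1}$ (i.e. $P_1=1$, $0\le P_i\le1$, $P_i=0$ for $i\ge7$) for which the flip dynamics for simultaneous edge $L$-colorings of $(G_1,G_2)$ has mixing time $O(m\log n)$.
   Context: Let $\widehat G$ be the graph with vertex set $E_1\cup E_2$ in which distinct $e,e'$ are adjacent iff they share an endpoint and both lie in $E_1$ or both lie in $E_2$. A (simultaneous edge) $L$-coloring is a map $\sigma$ with $\sigma(e)\in L(e)$ for all $e$; it is proper if adjacent vertices of $\widehat G$ receive distinct colors. Let $\Omega_L$ be the set of proper $L$-colorings; the chain's stationary distribution is uniform on $\Omega_L$. For a coloring $\sigma$, edge $e$ and color $c$, the cluster $S_\sigma(e,c)$ is the set of vertices of $\widehat G$ reachable from $e$ by a path alternating between colors $\sigma(e)$ and $c$ (with $S_\sigma(e,\sigma(e))=\{e\}$); it is flippable if $\{\sigma(e),c\}\subseteq L(w)$ for all $w\in S_\sigma(e,c)$. Flip dynamics step from $X_t$: choose $(e,i)\in(E_1\cup E_2)\times[k]$ uniformly, let $c$ be the $i$-th smallest element of $L(e)$, $s=|S_{X_t}(e,c)|$; if the cluster is flippable, with probability $P_s/s$ interchange colors $X_t(e)$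 and $c$ on it; otherwise stay. Mixing time: $T_{\mathrm{mix}}=\max_{X_0\in\Omega_L}\min\{t:d_{TV}(P^t(X_0,\cdot),\pi)\le1/4\}$ with $\pi$ uniform on $\Omega_L$. *)

(* Defs.v *)
From HB Require Import structures.
From mathcomp Require Import all_boot all_order all_algebra finmap.
From mathcomp Require Import all_classical all_reals all_analysis.

Set Implicit Arguments.
Unset Strict Implicit.
Unset Printing Implicit Defensive.

Import Order.TTheory GRing.Theory Num.Theory.

Local Open Scope ring_scope.

Section FiniteMarkovChains.
Variables (R : realType) (T : finType).

Fixpoint iter_kernel (K : T -> T -> R) (t : nat) (x y : T) : R :=
  if t is t'.+1 then \sum_(z : T) iter_kernel K t' x z * K z y
  else (y == x)%:R.

Definition uniform_on (A : {set T}) (x : T) : R :=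
  if x \in A then (#|A|%:R)^-1 else 0.

Definition tv_dist (mu nu : T -> R) : R :=
  2^-1 * \sum_(x : T) `|mu x - nu x|.

(* The infimum makes the time +oo when the threshold is never reached. *)
Definition mixing_time_from (K : T -> T -> R) (pi : T -> R) (x : T) : \bar R :=
  ereal_inf [set (t%:R)%:E | t in
    [set t : nat | tv_dist (iter_kernel K t x) pi <= 4^-1]]%classic.

Definition mixing_time (K : T -> T -> R) (A : {set T}) : \bar R :=
  \big[maxe/0%E]_(x in A) mixing_time_from K (uniform_on A) x.

End FiniteMarkovChains.

Section SimpleGraphs.
Variable V : finType.

(* A simple graph on V is given by its set of edges, which are pairs. *)
Definition simple_graph (E : {set {set V}}) : Prop :=
  forall e, e \in E -> #|e| = 2%N.

Definition degree (E : {set {set V}}) (v : V) : nat :=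
  #|[set e in E | v \in e]|.

Definition max_degree (E : {set {set V}}) : nat := \max_(v : V) degree E v.

End SimpleGraphs.

Section SimultaneousEdgeColorings.
Variables (V : finType) (E1 E2 : {set {set V}}).

Definition edge : finType := {e : {set V} | e \in E1 :|: E2}.

Definition adj : rel edge := fun e f =>
  [&& e != f, ~~ [disjoint val e & val f] &
      (val e \in E1) && (val f \in E1) || (val e \in E2) && (val f \in E2)].

Variable L : edge -> {fset nat}.

(* i counts from 0; the default value of nth is only reached for i >= #|L e| *)
Definition nth_color (e : edge) (i : nat) : nat :=
  nth 0%N (sort leq (enum_fset (L e))) i.

Definition list_type (e : edge) : finType := L e.

Definition coloring : finType := {dffun forall e : edge, list_type e}.

Definition color (s : coloring) (e : edge) : nat := val (s e).

Definition proper_colorings : {set coloring} :=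
  [set s : coloring | [forall e, forall f, adj e f ==> (color s e != color s f)]].

Definition alternates (s : coloring) (a c : nat) : rel edge := fun u v =>
  adj u v && ((color s u == a) && (color s v == c)
           || (color s u == c) && (color s v == a)).

Definition cluster (s : coloring) (e : edge) (c : nat) : {set edge} :=
  if c == color s e then [set e]
  else [set w | connect (alternates s (color s e) c) e w].

Definition flippable (s : coloring) (e : edge) (c : nat) : bool :=
  [forall w in cluster s e c, (color s e \in L w) && (c \in L w)].

Definition flipped_color (s : coloring) (e : edge) (c : nat) (w : edge) : nat :=
  if w \in cluster s e c then
    if color s w == color s e then c else color s e
  else color s w.

(* insubd only casts the new color to the list of w: its default value s w is
   never used when the cluster is flippable. *)
Definition flip (s : coloring) (e : edge) (c : nat) : coloring :=
  [ffun w => insubd (s w) (flipped_color s e c w)].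

Variable R : realType.

Definition local_flip_probabilities (l : nat) (P : nat -> R) : Prop :=
  [/\ P 1%N = 1,
      forall i, (1 <= i)%N -> 0 <= P i <= 1 &
      forall i, (l < i)%N -> P i = 0].

Definition flip_probability (P : nat -> R) (s : coloring) (e : edge) (c : nat) : R :=
  if flippable s e c then P #|cluster s e c| / #|cluster s e c|%:R else 0.

Definition move_probability (k : nat) (P : nat -> R) (s : coloring)
    (e : edge) (i : 'I_k) : R :=
  (#|edge| * k)%:R^-1 * flip_probability P s e (nth_color e i).

(* The last term collects the probability of all the ways to stay put; it also
   makes the chain on an edgeless pair of graphs the trivial one. *)
Definition flip_dynamics (k : nat) (P : nat -> R) (s s' : coloring) : R :=
  \sum_(e : edge) \sum_(i < k)
     move_probability P s e i * (s' == flip s e (nth_color e i))%:R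
  + (1 - \sum_(e : edge) \sum_(i < k) move_probability P s e i) * (s' == s)%:R.

End SimultaneousEdgeColorings.

Arguments flip_dynamics {V E1 E2} L {R} k P s s'.
Arguments proper_colorings {V E1 E2} L.

(* Main.v *)
(** Path coupling in dual form. Give an edge weight 41/20 if it lies in both
    graphs and 1 otherwise, and let K be the transition operator. It suffices
    that K contracts the Lipschitz constant of functions for the weighted
    Hamming distance by 1 - 1/(2000 m), which need only be checked on colorings
    s, t, proper or not, that differ at a single edge v.

    Only clusters containing v in s or in t contribute to K f s - K f t beyond
    f s - f t. For a color c of L v, they are the clusters of v itself and those
    of the neighbors of v of color c. If there is no such neighbor, the flips of
    v to c make s and t equal. If w is the only one, the flip of v to c in s is
    matched with the flip of w to the color of v in t, and conversely, so that w
    costs a factor P_i - P_(i+1) instead of P_i. If there are several, the flips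
    of v may be left unmatched. A shared edge has at most 4 Delta incidences in total,
    an unshared one at most 2 Delta neighbors, all possibly shared and heavier;
    the weight 41/20 balances the two cases, and unit rates for singletons alone
    would give the threshold 6 Delta with weight 2. *)

Require Import Defs.
From HB Require Import structures.
From mathcomp Require Import all_boot all_order all_algebra finmap.
From mathcomp Require Import all_classical all_reals all_analysis.
From mathcomp Require Import ring lra.

Set Implicit Arguments.
Unset Strict Implicit.
Unset Printing Implicit Defensive.

Import Order.TTheory GRing.Theory Num.Theory.

Local Open Scope ring_scope.

(* The cluster points of a filter would otherwise shadow the name. *)
Local Notation cluster := Defs.cluster.

(** Reachability arguments below use this induction principle: exhibit a set that the relation
    cannot leave. *)
Lemma connect_closed (T : finType) (r : rel T) (S : {set T}) :
  (forall u v, u \in S -> r u v -> v \in S) ->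
  forall u v, u \in S -> connect r u v -> v \in S.
Proof.
move=> cS u v uS /connectP[p + ->]; elim: p u uS => //= x p IH u uS /andP[rux].
exact/IH/(cS u).
Qed.

(** * Clusters and their flips *)

Section Clusters.
Variables (V : finType) (E1 E2 : {set {set V}}) (L : edge E1 E2 -> {fset nat}).
Implicit Types (s t : coloring L) (e u v w : edge E1 E2) (c d : nat).

Lemma adj_sym : symmetric (@adj V E1 E2).
Proof.
move=> e f; rewrite /adj eq_sym disjoint_sym; congr [&& _, _ & _].
by rewrite andbC [X in _ || X]andbC.
Qed.

Lemma adj_neq e f : adj e f -> f != e.
Proof. by case/andP; rewrite eq_sym. Qed.

Lemma color_in s e : color s e \in L e.
Proof. exact: valP. Qed.

Lemma color_inj s t : color s =1 color t -> s = t.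
Proof. by move=> st; apply/ffunP => e; apply/val_inj/st. Qed.

Lemma alternates_sym s c d : symmetric (alternates s c d).
Proof.
move=> u v; rewrite /alternates adj_sym orbC.
by rewrite ![(color s v == _) && _]andbC.
Qed.

Lemma alternatesC s c d : alternates s c d =2 alternates s d c.
Proof. by move=> u v; rewrite /alternates orbC. Qed.

Lemma mem_cluster s e c : e \in cluster s e c.
Proof. by rewrite /cluster; case: ifP; rewrite inE // connect0. Qed.

(** For [w] in the cluster, this is the color it receives in the flip, and also the one for which
    [w] selects this same cluster. *)
Definition opposite s e c w :=
  if color s w == color s e then c else color s e.

Lemma cluster_color s e c w :
  w \in cluster s e c -> (color s w == color s e) || (color s w == c).
Proof.
rewrite /cluster; case: ifP => _; rewrite inE; first by move=> /eqP->; rewrite eqxx.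
move=> ew; have := @connect_closed _ _ [set w | (color s w == color s e) ||
  (color s w == c)] _ e w _ ew; rewrite !inE eqxx; apply => // x y _.
by rewrite inE => /andP[_ /orP[]/andP[_ /eqP->]]; rewrite eqxx ?orbT.
Qed.

(** Alternation is symmetric in its two edges and in its two colors, so a nontrivial cluster is a
    connected component that any member can name. *)
Lemma cluster_opposite s e c w : w \in cluster s e c ->
  cluster s w (opposite s e c w) = cluster s e c.
Proof.
move=> wC; have := cluster_color wC; move: wC; rewrite /cluster /opposite.
have [->|ce] := eqVneq c (color s e).
  by rewrite inE => /eqP->; rewrite !eqxx.
rewrite inE => ew.
have cs := sym_connect_sym (alternates_sym s (color s e) c).
have [->|nwe] /= := eqVneq (color s w) (color s e); last move=> /eqP cw.
  move=> _; rewrite (negbTE ce); apply/setP => x; rewrite !inE.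
  by apply/esym/(same_connect cs ew).
rewrite cw eq_sym (negbTE ce); apply/setP => x; rewrite !inE.
rewrite (eq_connect (alternatesC s c _)); exact/esym/(same_connect cs ew).
Qed.

Lemma opposite_opposite s e c w x : w \in cluster s e c -> x \in cluster s e c ->
  opposite s w (opposite s e c w) x = opposite s e c x.
Proof.
move=> /cluster_color wC /cluster_color xC; move: wC xC; rewrite /opposite.
have [->|nw] /= := eqVneq (color s w) (color s e).
  by [].
have [->|nx] /= := eqVneq (color s x) (color s e).
  by move=> /eqP cw _; rewrite eq_sym (negbTE nw).
by move=> /eqP-> /eqP->; rewrite eqxx.
Qed.

Lemma flipped_opposite s e c w x : w \in cluster s e c ->
  flipped_color s w (opposite s e c w) x = flipped_color s e c x.
Proof.
move=> wC; rewrite /flipped_color cluster_opposite //; case: ifP => // xC.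
exact: opposite_opposite.
Qed.

Lemma flip_opposite s e c w : w \in cluster s e c ->
  flip s w (opposite s e c w) = flip s e c.
Proof. by move=> wC; apply/ffunP => x; rewrite !ffunE flipped_opposite. Qed.

Lemma flippable_mem s e c w : flippable s e c -> w \in cluster s e c ->
  (color s e \in L w) && (c \in L w).
Proof. by move/forall_inP; apply. Qed.

Lemma flippable_opposite_in s e c w : flippable s e c -> w \in cluster s e c ->
  opposite s e c w \in L w.
Proof. by move=> fl /(flippable_mem fl)/andP[? ?]; rewrite /opposite; case: ifP. Qed.

Lemma flippable_opposite s e c w : w \in cluster s e c ->
  flippable s w (opposite s e c w) = flippable s e c.
Proof.
move=> wC; rewrite /flippable cluster_opposite //; apply: eq_forallb_in => x xC.
move: (cluster_color wC); rewrite /opposite.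
by case: eqP => [->//|_ /= /eqP->]; rewrite andbC.
Qed.

Lemma color_flip s e c w : flippable s e c ->
  color (flip s e c) w = flipped_color s e c w.
Proof.
move=> fl; rewrite /color ffunE val_insubd ifT // /flipped_color.
case: ifP => [/(flippable_mem fl)/andP[? ?]|_]; last exact: color_in.
by case: ifP.
Qed.

Lemma color_flip_out s e c w : w \notin cluster s e c ->
  color (flip s e c) w = color s w.
Proof.
move=> wC; rewrite /color ffunE /flipped_color (negbTE wC) val_insubd.
by case: ifP.
Qed.

Lemma flip_trivial s e c : c = color s e -> flip s e c = s.
Proof.
move=> ce; apply: color_inj => w; have [wC|/color_flip_out//] := boolP (w \in cluster s e c).
rewrite color_flip; last first.
  by rewrite ce /flippable; apply/forall_inP=> x; rewrite /cluster eqxx inE => /eqP->; rewrite color_in.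
by rewrite /flipped_color wC; move: wC; rewrite /cluster ce eqxx inE => /eqP->; rewrite eqxx.
Qed.


(** * Clusters in two colorings that differ at one edge *)

Section TwoColorings.
Variables (s t : coloring L) (v : edge E1 E2).
Hypothesis st : forall e, e != v -> color s e = color t e.

(** Alternating paths of [s] that avoid [v] meet only edges where [s] and [t] agree, so they survive
    in [t]. The cluster in [t] may still grow through [v]. *)
Lemma cluster_sub e c : v \notin cluster s e c -> cluster s e c \subset cluster t e c.
Proof.
move=> vC; have ev : e != v by apply: contraNneq vC => <-; exact: mem_cluster.
move: vC; rewrite /cluster -st //; case: eqP => // _; rewrite inE => vC.
apply/fintype.subsetP => x; rewrite !inE => ex.
suff : x \in [set x | connect (alternates s (color s e) c) e x &&
                      connect (alternates t (color s e) c) e x].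
  by rewrite inE => /andP[].
apply: connect_closed ex; last by rewrite inE !connect0.
move=> y z; rewrite !inE => /andP[sy ty] yz.
have sz : connect (alternates s (color s e) c) e z.
  exact: connect_trans sy (connect1 yz).
rewrite sz; apply: connect_trans ty (connect1 _).
have yv : y != v by apply: contraNneq vC => <-.
have zv : z != v by apply: contraNneq vC => <-.
by move: yz; rewrite /alternates !st.
Qed.

Lemma opposite_agree e c w : e != v -> w != v -> opposite s e c w = opposite t e c w.
Proof. by move=> ev wv; rewrite /opposite !st. Qed.

End TwoColorings.

Lemma cluster_eq s t v e c : (forall e, e != v -> color s e = color t e) ->
  v \notin cluster s e c -> v \notin cluster t e c -> cluster s e c = cluster t e c.
Proof.
move=> st sv tv; apply/eqP; rewrite finset.eqEsubset !(cluster_sub (v := v)) //.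
by move=> x /st.
Qed.

Section OneVertexChange.
Variables (s t : coloring L) (v : edge E1 E2).
Hypothesis st : forall e, e != v -> color s e = color t e.

(** Without such a last edge before [v], the cluster in [s] would be closed under alternation in [t]
    and so contain [v]. *)
Lemma cluster_disagree e c : e != v -> v \notin cluster s e c ->
  v \in cluster t e c ->
  exists2 w, adj v w & [/\ w \in cluster s e c, color s w != color t v &
    opposite s e c w = color t v].
Proof.
move=> ev vs; have [ce|ce] := eqVneq c (color s e).
  by rewrite /cluster -(st ev) ce eqxx inE eq_sym (negbTE ev).
move=> vt; case: (pickP [pred w | adj v w && (w \in cluster s e c) &&
    alternates t (color t e) c w v]) => [w /= /andP[/andP[vw wC] alt]|no].
  have wv : w != v by exact: adj_neq vw.
  exists w => //; move: alt; rewrite /alternates /opposite -(st ev) -(st wv).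
  case/andP=> _ /orP[]/andP[/eqP-> /eqP->].
    by rewrite eq_sym ce eqxx.
  by rewrite ce (negbTE ce).
suff : v \in cluster s e c by rewrite (negbTE vs).
move: vt; rewrite {1}/cluster -(st ev) (negbTE ce) inE.
apply: connect_closed; last exact: mem_cluster.
move=> x y xC; have xv : x != v by apply: contraNneq vs => <-.
have [->|yv] := eqVneq y v; move=> alt.
  have := no x; rewrite /= xC -(st ev) alt !andbT.
  by case/andP: alt; rewrite adj_sym => ->.
move: xC; rewrite /cluster (negbTE ce) !inE => ex; apply: connect_trans ex (connect1 _).
by move: alt; rewrite /alternates !st.
Qed.

Lemma neighbor_in_cluster w : adj v w -> color s w != color t v ->
  v \in cluster t w (color t v).
Proof.
move=> vw cw; rewrite /cluster -(st (adj_neq vw)) eq_sym (negbTE cw) inE.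
by apply: connect1; rewrite /alternates adj_sym vw -(st (adj_neq vw)) !eqxx.
Qed.

Lemma neighbor_cluster_sub e c w : v \notin cluster s e c -> w \in cluster s e c ->
  adj v w -> color s w != color t v -> opposite s e c w = color t v ->
  v \in cluster t e c.
Proof.
move=> vs wC vw cw ow.
have ev : e != v by apply: contraNneq vs => <-; exact: mem_cluster.
have wt : w \in cluster t e c by apply: (fintype.subsetP (cluster_sub st vs)).
rewrite -(cluster_opposite wt) -(opposite_agree st) ?(adj_neq vw)// ow.
exact: neighbor_in_cluster.
Qed.

Lemma cluster_center_subset c : c != color t v ->
  forall w, adj v w -> color s w = c -> w \in cluster t v c.
Proof.
move=> cv w vw cw; rewrite /cluster (negbTE cv) inE; apply: connect1.
by rewrite /alternates vw -(st (adj_neq vw)) cw !eqxx.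
Qed.

Lemma cluster_center_free c : (forall w, adj v w -> color s w != c) ->
  cluster t v c = [set v].
Proof.
move=> free; rewrite /cluster; case: (eqVneq c (color t v)) => // cv.
apply/setP => x; rewrite !inE; apply/idP/eqP => [vx|->]; last exact: connect0.
apply/set1P; apply: connect_closed vx; last exact: set11.
move=> u y /set1P-> /andP[vy]; rewrite eqxx -(st (adj_neq vy)) (negbTE (free _ vy)).
by rewrite eq_sym (negbTE cv).
Qed.

(** A path leaving [v] must pass through [w], and beyond it alternation in [t] is alternation in
    [s]. The one extra edge is what sets [P_(i+1)] against [P_i]. *)
Lemma cluster_center_single c w : c != color t v -> adj v w -> color s w = c ->
  (forall u, adj v u -> color s u = c -> u = w) ->
  v \notin cluster s w (color t v) ->
  cluster t v c = v |: cluster s w (color t v).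
Proof.
move=> cv vw cw single vs.
have wv := adj_neq vw.
apply/eqP; rewrite finset.eqEsubset; apply/andP; split; last first.
  apply/fintype.subsetP => x /setU1P[->|xC]; first exact: mem_cluster.
  have wC := cluster_center_subset cv vw cw.
  rewrite -(cluster_opposite wC) /opposite -st // cw (negbTE cv).
  exact: fintype.subsetP (cluster_sub st vs) x xC.
apply/fintype.subsetP => x; rewrite {1}/cluster (negbTE cv) inE.
apply: connect_closed; last by rewrite setU11.
move=> u y /setU1P[->|uC] alt.
  move: alt => /andP[vy]; rewrite -(st (adj_neq vy)) eqxx [color t v == c]eq_sym (negbTE cv) orbF /=.
  by move=> /eqP cy; rewrite (single y) // in_setU1 mem_cluster orbT.
have [->|yv] := eqVneq y v; first exact: setU11.
have uv : u != v by apply: contraNneq vs => uv; rewrite -{1}uv.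
rewrite in_setU1 (negbTE yv) /=.
move: uC; rewrite /cluster cw eq_sym (negbTE cv) !inE => uC.
apply: connect_trans uC (connect1 _).
by rewrite alternatesC; move: alt; rewrite /alternates !st.
Qed.

Lemma flippable_center_single c w : c != color t v -> adj v w -> color s w = c ->
  (forall u, adj v u -> color s u = c -> u = w) ->
  v \notin cluster s w (color t v) -> c \in L v ->
  flippable t v c = flippable s w (color t v).
Proof.
move=> cv vw cw single vs cL; rewrite /flippable (cluster_center_single cv vw cw) //.
apply/forall_inP/forall_inP => fl x xC.
  by rewrite cw andbC fl // in_setU1 xC orbT.
move: xC; rewrite in_setU1 => /orP[/eqP->|/fl]; last by rewrite cw andbC.
by rewrite cL color_in.
Qed.

End OneVertexChange.

End Clusters.

(** * Grouping moves by the flip they perform *)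

Section Slots.
Variables (V : finType) (E1 E2 : {set {set V}}) (L : edge E1 E2 -> {fset nat}).
Variables (k : nat) (R : realType) (P : nat -> R).
Hypothesis Lk : forall e, #|` L e| = k.
Implicit Types (s t : coloring L) (e u v w : edge E1 E2) (c d : nat).
Local Notation slot := (edge E1 E2 * 'I_k)%type.

Definition slot_color (z : slot) := nth_color L z.1 z.2.

Lemma nth_color_in e (i : 'I_k) : nth_color L e i \in L e.
Proof.
rewrite /nth_color -[_ \in L e](mem_sort leq) mem_nth // size_sort.
by rewrite -[size _]/(#|` L e|) Lk.
Qed.

Lemma nth_color_inj e : injective (fun i : 'I_k => nth_color L e i).
Proof.
move=> i j /eqP; rewrite nth_uniq ?size_sort ?sort_uniq ?fset_uniq //; last 2 first.
- by rewrite -[size _]/(#|` L e|) Lk.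
- by rewrite -[size _]/(#|` L e|) Lk.
by move=> /eqP ij; apply: val_inj.
Qed.

Lemma nth_color_surj e c : c \in L e -> {i : 'I_k | nth_color L e i = c}.
Proof.
move=> cL; have cs : c \in sort leq (enum_fset (L e)) by rewrite mem_sort.
have ik : (index c (sort leq (enum_fset (L e))) < k)%N.
  by rewrite -(Lk e) -(size_sort leq) index_mem.
by exists (Ordinal ik); rewrite /nth_color /= nth_index.
Qed.

Lemma sum_nth_color_eq e c : c \in L e ->
  \sum_(i < k) (nth_color L e i == c)%:R = 1 :> R.
Proof.
move=> /nth_color_surj[j <-]; rewrite (bigD1 j) //= eqxx big1 ?addr0 // => i ij.
by rewrite (inj_eq (@nth_color_inj e)) (negbTE ij).
Qed.

(* The moves (e, c) and (w, d) select the same cluster and the same flip. *)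
Definition same_flip s e c w d := (w \in cluster s e c) && (d == opposite s e c w).

Lemma same_flip_refl s e c : same_flip s e c e c.
Proof. by rewrite /same_flip mem_cluster /opposite !eqxx. Qed.

Lemma same_flip_sym s e c w d : same_flip s e c w d = same_flip s w d e c.
Proof.
suff imp e' c' w' d' : same_flip s e' c' w' d' -> same_flip s w' d' e' c'.
  by apply/idP/idP; apply: imp.
case/andP=> wC /eqP->; rewrite /same_flip cluster_opposite // mem_cluster.
by rewrite opposite_opposite ?mem_cluster // /opposite eqxx eqxx.
Qed.

Lemma same_flip_eql s e c w d : same_flip s e c w d ->
  same_flip s e c =2 same_flip s w d.
Proof.
case/andP=> wC /eqP-> u b; rewrite /same_flip cluster_opposite //.
by case: (boolP (u \in _)) => //= uC; rewrite opposite_opposite.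
Qed.

Definition flip_rate s e c : R :=
  if flippable s e c then P #|cluster s e c| else 0.

Lemma flip_probabilityE s e c :
  flip_probability P s e c = flip_rate s e c / #|cluster s e c|%:R.
Proof. by rewrite /flip_probability /flip_rate; case: ifP; rewrite ?mul0r. Qed.

Lemma card_cluster_gt0 s e c : (0 < #|cluster s e c|)%N.
Proof. by apply/card_gt0P; exists e; exact: mem_cluster. Qed.

Lemma same_flip_probability s e c w d : same_flip s e c w d ->
  flip_probability P s w d = flip_probability P s e c.
Proof.
case/andP=> wC /eqP->.
by rewrite /flip_probability flippable_opposite // cluster_opposite.
Qed.

(** Flippability puts the opposite color of each member into its list, so each member accounts for
    exactly one move. This cancels the division by the cluster size. *)
Lemma sum_same_flip s e c : flippable s e c ->
  \sum_(z : slot | same_flip s e c z.1 (slot_color z)) 1 = #|cluster s e c|%:R :> R.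
Proof.
move=> fl; transitivity (\sum_(w in cluster s e c) \sum_(i < k)
    (nth_color L w i == opposite s e c w)%:R : R).
  rewrite pair_big_dep /= [LHS]big_mkcond [RHS]big_mkcond /=.
  apply: eq_bigr => -[w i] _ /=; rewrite /same_flip /slot_color /= andbT.
  by case: (w \in _) => //=; case: (_ == _).
rewrite (eq_bigr (fun=> 1)) ?sumr_const // => w wC.
by rewrite sum_nth_color_eq // flippable_opposite_in.
Qed.

(* The moves selecting one flip have total probability [flip_rate]; it is shared
   equally among the indices j representing that flip. *)
Lemma cluster_orbit_sum s (J : finType) (A : pred J) (y : J -> edge E1 E2)
    (c : J -> nat) (Q : pred slot) (F : edge E1 E2 -> nat -> R) :
  (forall e d w, w \in cluster s e d -> F w (opposite s e d w) = F e d) ->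
  (forall z, Q z -> flippable s z.1 (slot_color z) ->
     exists2 j, A j & same_flip s z.1 (slot_color z) (y j) (c j)) ->
  (forall j z, A j -> flippable s (y j) (c j) ->
     same_flip s (y j) (c j) z.1 (slot_color z) -> Q z) ->
  \sum_(z | Q z) flip_probability P s z.1 (slot_color z) * F z.1 (slot_color z) =
  \sum_(j | A j) flip_rate s (y j) (c j) /
    #|[set i | A i & same_flip s (y j) (c j) (y i) (c i)]|%:R * F (y j) (c j).
Proof.
move=> Finv QA AQ; pose n j := #|[set i | A i & same_flip s (y j) (c j) (y i) (c i)]|.
pose sf (z : slot) j := same_flip s z.1 (slot_color z) (y j) (c j).
(* The term of each move is split equally among the indices representing its flip, whose number [n]
   is the same for all of them; then the sums are exchanged. *)
transitivity (\sum_(z | Q z) \sum_(j | A j && sf z j)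
    (n j)%:R^-1 * (flip_probability P s (y j) (c j) * F (y j) (c j))).
  apply: eq_bigr => z Qz.
  have FP j : sf z j -> flip_probability P s (y j) (c j) * F (y j) (c j) =
      flip_probability P s z.1 (slot_color z) * F z.1 (slot_color z).
    move=> zj; rewrite (same_flip_probability zj); congr (_ * _).
    by case/andP: zj => jC /eqP->; exact: Finv.
  have [fl|nfl] := boolP (flippable s z.1 (slot_color z)); last first.
    rewrite {1}/flip_probability (negbTE nfl) mul0r big1 // => j /andP[_ zj].
    by rewrite FP // /flip_probability (negbTE nfl) mul0r mulr0.
  have [j0 Aj0 zj0] := QA z Qz fl.
  rewrite (eq_bigr (fun=> (n j0)%:R^-1 * (flip_probability P s z.1 (slot_color z) *
      F z.1 (slot_color z)))); last first.
    move=> j /andP[Aj zj]; rewrite FP //; congr (_%:R^-1 * _).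
    rewrite /n; apply: eq_card => i; rewrite !inE.
    by rewrite -(same_flip_eql zj) (same_flip_eql zj0).
  rewrite sumr_const -[RHS]mulr_natl mulrA.
  have -> : #|[pred j | A j && sf z j]| = n j0.
    by apply: eq_card => i; rewrite !inE -(same_flip_eql zj0).
  rewrite divff ?mul1r // pnatr_eq0 -lt0n; apply/card_gt0P; exists j0.
  by rewrite !inE Aj0 same_flip_refl.
rewrite (exchange_big_dep A) /=; last by move=> z j _ /andP[].
apply: eq_bigr => j Aj; rewrite -big_distrr /= flip_probabilityE.
have [fl|nfl] := boolP (flippable s (y j) (c j)); last first.
  by rewrite /flip_rate (negbTE nfl) !mul0r big1 ?mulr0.
rewrite (eq_bigl (fun z : slot => same_flip s (y j) (c j) z.1 (slot_color z))); last first.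
  move=> z /=; rewrite Aj /sf same_flip_sym andbC /=.
  by case: (boolP (same_flip _ _ _ _ _)) => //= /(AQ _ _ Aj fl) ->.
rewrite (eq_bigr (fun=> flip_rate s (y j) (c j) / #|cluster s (y j) (c j)|%:R *
  F (y j) (c j) * 1)); last by move=> z _; rewrite mulr1.
rewrite -mulr_sumr sum_same_flip // [_ / _ * F _ _]mulrAC divfK; last first.
  by rewrite pnatr_eq0 -lt0n card_cluster_gt0.
by rewrite mulrA [_^-1 * _]mulrC.
Qed.

(** * Reversibility of flips *)

Section Reversal.
Variables (s : coloring L) (e : edge E1 E2) (c : nat).
Hypotheses (sP : s \in proper_colorings L) (fl : flippable s e c).
Local Notation t := (flip s e c).

Lemma proper_neq u v : adj u v -> color s u != color s v.
Proof. by move: sP; rewrite inE => /'forall_forallP/(_ u v)/implyP. Qed.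

Lemma color_flip_opposite w : w \in cluster s e c -> color t w = opposite s e c w.
Proof. by move=> wC; rewrite color_flip // /flipped_color wC. Qed.

Lemma cluster_closed u x : c != color s e -> u \in cluster s e c ->
  alternates s (color s e) c u x -> x \in cluster s e c.
Proof.
move=> ce; rewrite /cluster (negbTE ce) !inE => eu ux.
exact: connect_trans eu (connect1 ux).
Qed.

Lemma flip_proper : t \in proper_colorings L.
Proof.
have [/flip_trivial->//|ce] := eqVneq c (color s e).
rewrite inE; apply/'forall_forallP => u x; apply/implyP => ux.
have := proper_neq ux.
(* If the new color of [y] were that of an outside neighbor [z], then [z] would alternate with [y]
   already in [s] and lie in the cluster. *)
have out y z : y \in cluster s e c -> z \notin cluster s e c -> adj y z ->
    color s y != color s z -> opposite s e c y != color s z.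
  move=> yC zC yz nyz; apply: contra zC => /eqP oz; apply: (cluster_closed ce yC).
  rewrite /alternates yz -oz /opposite; move: (cluster_color yC).
  by case: eqP => [_ _|_ /= /eqP ->]; rewrite !eqxx ?orbT.
have [uC|uC] := boolP (u \in cluster s e c); have [xC|xC] := boolP (x \in cluster s e c).
- rewrite !color_flip_opposite // /opposite.
  move: (cluster_color uC); case: (color s u =P color s e) => [-> _|_ /= /eqP->];
    move: (cluster_color xC); case: (color s x =P color s e) => [-> _|_ /= /eqP->];
    by rewrite ?eqxx // eq_sym.
- by rewrite (color_flip_opposite uC) (color_flip_out xC); exact: out.
- rewrite (color_flip_out uC) (color_flip_opposite xC) eq_sym => nux.
  by rewrite eq_sym; apply: out; rewrite // adj_sym.
- by rewrite !color_flip_out.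
Qed.

(** For [x] outside the cluster both sides fail: the right one by closure, the left one because it
    would give [x] the color of [u] in [s], against properness. *)
Lemma alternates_flip u x : c != color s e -> u \in cluster s e c ->
  alternates t c (color s e) u x = alternates s (color s e) c u x.
Proof.
move=> ce uC; have [xC|xC] := boolP (x \in cluster s e c).
  rewrite /alternates !color_flip_opposite // /opposite.
  have ec : (color s e == c) = false by rewrite eq_sym (negbTE ce).
  move: (cluster_color uC); case: (color s u =P color s e) => [cu _|_ /= /eqP cu];
    move: (cluster_color xC); case: (color s x =P color s e) => [cx _|_ /= /eqP cx];
    by rewrite ?cu ?cx ?eqxx ?(negbTE ce) ?ec.
rewrite [RHS](contraNF _ xC); last exact: cluster_closed.
rewrite /alternates (color_flip_out xC) color_flip_opposite //.
apply/negbTE; rewrite negb_and; have [ux|//] := boolP (adj u x).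
move: (proper_neq ux) => /= nux; apply: contra nux; rewrite /opposite.
have ec : (color s e == c) = false by rewrite eq_sym (negbTE ce).
move: (cluster_color uC); case: eqP => [->|_ /= /eqP->];
  by rewrite ?eqxx ?(negbTE ce) ?ec /= ?orbF // eq_sym.
Qed.

Lemma cluster_flip : cluster t e (color s e) = cluster s e c.
Proof.
have [ce|ce] := eqVneq c (color s e); first by rewrite (flip_trivial ce) ce.
have te : color t e = c.
  by rewrite color_flip_opposite ?mem_cluster // /opposite eqxx.
apply/eqP; rewrite finset.eqEsubset; apply/andP; split; apply/fintype.subsetP => x.
  rewrite {1}/cluster te eq_sym (negbTE ce) inE => ex.
  apply: connect_closed ex; last exact: mem_cluster.
  by move=> u y uC; rewrite alternates_flip //; exact: cluster_closed.
rewrite {1}/cluster (negbTE ce) inE => ex.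
suff : x \in cluster s e c :&: cluster t e (color s e) by case/setIP.
apply: connect_closed ex; last by rewrite inE !mem_cluster.
move=> u y; rewrite !inE => /andP[uC ut] uy; rewrite (cluster_closed ce uC uy) /=.
move: ut; rewrite /cluster te eq_sym (negbTE ce) !inE => eu.
by apply: connect_trans eu (connect1 _); rewrite alternates_flip.
Qed.

Lemma color_flip_center : color t e = c.
Proof. by rewrite color_flip_opposite ?mem_cluster // /opposite eqxx. Qed.

Lemma flippable_flip : flippable t e (color s e).
Proof.
apply/forall_inP => w; rewrite cluster_flip color_flip_center andbC.
exact: flippable_mem.
Qed.

Lemma flip_flip : flip t e (color s e) = s.
Proof.
apply: color_inj => w; rewrite color_flip ?flippable_flip // /flipped_color cluster_flip.
case: ifP => [wC|/negbT/color_flip_out//].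
rewrite color_flip_center color_flip_opposite // /opposite.
move: (cluster_color wC); case: eqP => [->|nwe /= /eqP->]; rewrite ?eqxx //.
by case: eqP => // ec; rewrite ec.
Qed.

End Reversal.

(** This is stationarity of the uniform distribution in dual form. Undoing a flip has the same
    probability as the flip, so the sums of the two terms of the difference agree. *)
Lemma sum_proper_gain (f : coloring L -> R) :
  \sum_(s in proper_colorings L) \sum_(z : slot)
    flip_probability P s z.1 (slot_color z) *
      (f (flip s z.1 (slot_color z)) - f s) = 0.
Proof.
rewrite exchange_big /= -[LHS](pair_bigA _ (fun e (i : 'I_k) => \sum_(s in proper_colorings L)
  flip_probability P s e (nth_color L e i) * (f (flip s e (nth_color L e i)) - f s))) /=.
rewrite big1 // => e _; rewrite exchange_big /=.
have idx s := nth_color_surj (color_in s e).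
pose D (p : coloring L * 'I_k) :=
  (p.1 \in proper_colorings L) && flippable p.1 e (nth_color L e p.2).
(* A flip is undone from the same edge by the index of its old color. Pairs outside [D] are fixed,
   which makes [phi] an involution everywhere. *)
pose phi (p : coloring L * 'I_k) :=
  if D p then (flip p.1 e (nth_color L e p.2), sval (idx p.1)) else p.
have phiD p : D (phi p) = D p.
  rewrite {2}/D /phi; case: ifP => // /andP[sP fl]; rewrite /D /= flip_proper //=.
  by rewrite (svalP (idx p.1)) flippable_flip // sP fl.
have phiK : involutive phi.
  move=> p; rewrite {1}/phi phiD; case: ifP => [Dp|]; last by rewrite /phi => ->.
  rewrite /phi Dp /=; case/andP: Dp => sP fl; rewrite (svalP (idx p.1)) flip_flip //.
  rewrite [RHS]surjective_pairing; congr (_, _).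
  apply: (@nth_color_inj e); rewrite (svalP (idx _)); exact: color_flip_center.
pose w (p : coloring L * 'I_k) := flip_probability P p.1 e (nth_color L e p.2).
transitivity (\sum_(p | D p) w p * (f (phi p).1 - f p.1)).
  rewrite pair_big_dep /= big_mkcond [RHS]big_mkcond /=; apply: eq_bigr => -[s i] _.
  rewrite /w /phi /D /= /flip_probability andbT; case: (s \in _) => //=.
  by case: ifP => //=; rewrite mul0r.
have wphi p : D p -> w (phi p) = w p.
  move=> Dp; rewrite /w /phi Dp /=; case/andP: Dp => sP fl; rewrite (svalP (idx p.1)).
  by rewrite /flip_probability flippable_flip // fl cluster_flip.
under eq_bigr do rewrite mulrBr; rewrite big_split /= sumrN; apply/eqP; rewrite subr_eq0.
rewrite (reindex_inj (inv_inj phiK)) /=; apply/eqP; apply: eq_big => [p|p]; first exact: phiD.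
by rewrite phiD => Dp; rewrite wphi // phiK.
Qed.

End Slots.

(** * Flip probabilities *)

Section Rates.
Variable R : realType.

(* These make (i - 1) * (P_i - P_(i+1)) equal to 3/100 for i = 2, ..., 6. As
   1 + 1/2 + ... + 1/5 exceeds 41/20, the gain P_2 on a singleton cluster outweighs
   the cost 41/20 * 3/100 of a larger cluster matched with it. *)
Definition rates : seq R :=
  [:: 0; 1; 137/2000; 77/2000; 47/2000; 27/2000; 12/2000].

Definition rate (i : nat) : R := nth 0 rates i.

Definition drop_rate i := rate i - rate i.+1.

Lemma rate_default i : rate i.+4.+3 = 0.
Proof. by rewrite /rate nth_default. Qed.

Lemma rate_ge0 i : 0 <= rate i.
Proof. by do 7?[case: i => [|i]; first by rewrite /rate /=; lra]; rewrite rate_default. Qed.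

Lemma rate_le1 i : rate i <= 1.
Proof. by do 7?[case: i => [|i]; first by rewrite /rate /=; lra]; rewrite rate_default ler01. Qed.

Lemma rate_local : local_flip_probabilities 6 rate.
Proof.
split => // [i _|i i6]; first by rewrite rate_ge0 rate_le1.
by rewrite /rate nth_default.
Qed.

Lemma rate_le i : (1 < i)%N -> rate i <= 137/2000.
Proof.
case: i => [|[|i]] // _.
by do 5?[case: i => [|i]; first by rewrite /rate /=; lra]; rewrite rate_default; lra.
Qed.

(** Here [i] counts the edges of a cluster besides a chosen one, each of weight at most 41/20. The
    largest value, 0.15785, occurs at [i = 2]. *)
Lemma rate_size i : rate i.+1 * (41/20 * i%:R) <= 79/500.
Proof.
by do 6?[case: i => [|i]; first by rewrite /rate /=; lra]; rewrite rate_default mul0r; lra.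
Qed.

Lemma drop_rate_ge0 i : (0 < i)%N -> 0 <= drop_rate i.
Proof.
case: i => // i _; rewrite /drop_rate; do 5?[case: i => [|i]; first by rewrite /rate /=; lra].
by rewrite rate_default subr0 rate_ge0.
Qed.

Lemma drop_rate1 : drop_rate 1 = 1863/2000.
Proof. by rewrite /drop_rate /rate /=; lra. Qed.

Lemma drop_rate_le i : (1 < i)%N -> drop_rate i <= 3/100.
Proof.
case: i => [|[|i]] // _; rewrite /drop_rate; do 5?[case: i => [|i]; first by rewrite /rate /=; lra].
by rewrite !rate_default; lra.
Qed.

(** The rates are chosen for this: equality holds for [i] from 1 to 5. *)
Lemma drop_rate_size i : drop_rate i.+1 * (41/20 * i%:R) <= 123/2000.
Proof.
rewrite /drop_rate; do 6?[case: i => [|i]; first by rewrite /rate /=; lra].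
by rewrite !rate_default subr0 mul0r; lra.
Qed.

End Rates.

(** * Two colorings differing at one edge *)

Section OneStep.
Variables (V : finType) (E1 E2 : {set {set V}}) (L : edge E1 E2 -> {fset nat}).
Variable R : realType.
Implicit Types (s t : coloring L) (e u v w : edge E1 E2) (c d : nat).
Local Notation P := (rate R).

Definition shared e := (val e \in E1) && (val e \in E2).
Definition weight e : R := if shared e then 41/20 else 1.
Definition weight_of (S : {set edge E1 E2}) : R := \sum_(e in S) weight e.

Lemma weight_ge1 e : 1 <= weight e.
Proof. by rewrite /weight; case: ifP => _; lra. Qed.

Lemma weight_le e : weight e <= 41/20.
Proof. by rewrite /weight; case: ifP => _; lra. Qed.

Lemma weight_ge0 e : 0 <= weight e.
Proof. exact: le_trans (weight_ge1 e). Qed.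

Lemma weight_of_ge0 S : 0 <= weight_of S.
Proof. by apply: sumr_ge0 => e _; exact: weight_ge0. Qed.

Lemma weight_ofD1 e (S : {set edge E1 E2}) : e \in S -> weight_of S = weight e + weight_of (S :\ e).
Proof. by move=> eS; rewrite /weight_of (big_setD1 e). Qed.

Lemma weight_of1 e : weight_of [set e] = weight e.
Proof. by rewrite /weight_of big_set1. Qed.

Lemma weight_ofU (A B : {set edge E1 E2}) : weight_of (A :|: B) <= weight_of A + weight_of B.
Proof.
rewrite /weight_of [leLHS]big_mkcond [X in _ <= X + _]big_mkcond.
rewrite [X in _ <= _ + X]big_mkcond -big_split /=; apply: ler_sum => e _.
by rewrite inE; have := weight_ge0 e; case: (e \in A); case: (e \in B) => /=; lra.
Qed.

Lemma weight_of_card (A : {set edge E1 E2}) : weight_of A <= 41/20 * #|A|%:R.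
Proof.
rewrite -sum1_card natr_sum mulr_sumr; apply: ler_sum => e _; rewrite mulr1.
exact: weight_le.
Qed.

Definition weight_rest s e c := weight_of (cluster s e c :\ e).

Lemma weight_rest_ge0 s e c : 0 <= weight_rest s e c.
Proof. exact: weight_of_ge0. Qed.

Lemma weight_cluster s e c : weight_of (cluster s e c) = weight e + weight_rest s e c.
Proof. by rewrite (weight_ofD1 (mem_cluster s e c)). Qed.

Lemma weight_rest_le s e c : weight_rest s e c <= 41/20 * (#|cluster s e c|.-1)%:R.
Proof.
apply: le_trans (weight_of_card _) _.
by rewrite [#|cluster s e c|](cardsD1 e) mem_cluster.
Qed.

Lemma rate_rest s e c (p : R) : 0 <= p -> p <= P #|cluster s e c| ->
  p * weight_rest s e c <= 79/500.
Proof.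
move=> p0; have := weight_rest_le s e c; have := card_cluster_gt0 s e c.
case: #|cluster s e c| => // n _ wr pP; apply: le_trans (rate_size R n).
by apply: ler_pM => //; exact: weight_rest_ge0.
Qed.

Lemma drop_rate_rest s e c (p : R) : 0 <= p -> p <= drop_rate R #|cluster s e c| ->
  p * weight_rest s e c <= 123/2000.
Proof.
move=> p0; have := weight_rest_le s e c; have := card_cluster_gt0 s e c.
case: #|cluster s e c| => // n _ wr pP; apply: le_trans (drop_rate_size R n).
by apply: ler_pM => //; exact: weight_rest_ge0.
Qed.

Lemma cluster1_rest s e c : #|cluster s e c| = 1%N -> weight_rest s e c = 0.
Proof.
move=> C1; apply/eqP; rewrite eq_le weight_rest_ge0 andbT.
by apply: le_trans (weight_rest_le _ _ _) _; rewrite C1 mulr0.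
Qed.

(** If one cluster is a singleton, its rest vanishes and 79/500 is paid once. Otherwise the maximum
    is at most 137/2000, and what is saved on [weight e] covers the second 79/500. *)
Lemma rate_pair s t e c d (p q : R) :
  0 <= p -> 0 <= q -> p <= P #|cluster s e c| -> q <= P #|cluster t e d| ->
  Num.max p q * weight e + p * weight_rest s e c + q * weight_rest t e d <=
    weight e + 79/500.
Proof.
move=> p0 q0 pP qP; have := rate_rest p0 pP; have := rate_rest q0 qP.
have p1 := le_trans pP (rate_le1 _ _); have q1 := le_trans qP (rate_le1 _ _).
have w1 := weight_ge1 e.
have m1 : Num.max p q * weight e <= weight e.
  by rewrite ler_piMl ?weight_ge0 // ge_max p1 q1.
have := card_cluster_gt0 s e c; rewrite leq_eqVlt => /orP[/eqP/esym C1|C1].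
  by rewrite (cluster1_rest C1); lra.
have := card_cluster_gt0 t e d; rewrite leq_eqVlt => /orP[/eqP/esym D1|D1].
  by rewrite (cluster1_rest D1); lra.
have {}m1 : Num.max p q * weight e <= 137/2000 * weight e.
  rewrite ler_wpM2r ?weight_ge0 // ge_max.
  by rewrite (le_trans pP (rate_le R C1)) (le_trans qP (rate_le R D1)).
lra.
Qed.

Lemma drop_rate_pair s t e c d (p q : R) : 0 <= p -> 0 <= q ->
  p <= drop_rate R #|cluster s e c| -> q <= drop_rate R #|cluster t e d| ->
  Num.max p q * weight e + p * weight_rest s e c + q * weight_rest t e d <=
    1863/2000 * weight e + 123/2000.
Proof.
move=> p0 q0 pP qP; have := drop_rate_rest p0 pP; have := drop_rate_rest q0 qP.
have w1 := weight_ge1 e.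
have big i : (0 < i)%N -> drop_rate R i <= 1863/2000.
  case: i => [|[|i]] // _; first by rewrite drop_rate1.
  by apply: le_trans (drop_rate_le R (isT : (1 < i.+2)%N)) _; lra.
have m1 : Num.max p q * weight e <= 1863/2000 * weight e.
  rewrite ler_wpM2r ?weight_ge0 // ge_max.
  by rewrite (le_trans pP) ?(le_trans qP) ?big ?card_cluster_gt0.
have := card_cluster_gt0 s e c; rewrite leq_eqVlt => /orP[/eqP/esym C1|C1].
  by rewrite (cluster1_rest C1); lra.
have := card_cluster_gt0 t e d; rewrite leq_eqVlt => /orP[/eqP/esym D1|D1].
  by rewrite (cluster1_rest D1); lra.
have {}m1 : Num.max p q * weight e <= 3/100 * weight e.
  rewrite ler_wpM2r ?weight_ge0 // ge_max.
  by rewrite (le_trans pP (drop_rate_le R C1)) (le_trans qP (drop_rate_le R D1)).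
lra.
Qed.

(** The distance is the weighted Hamming distance. Any [S] containing the disagreements is allowed,
    and exchanging [s] and [t] gives the other sign. *)
Definition lipschitz (K : R) (f : coloring L -> R) :=
  forall s t (S : {set edge E1 E2}), (forall e, e \notin S -> color s e = color t e) ->
    f s - f t <= K * weight_of S.

Definition gain (f : coloring L -> R) s e c := f (flip s e c) - f s.

(* The cluster of w for the color b would absorb v if v had color b. *)
Definition neighbor_rep s b v w :=
  [&& adj v w, color s w != b & v \notin cluster s w b].

(** Several neighbors of [v] may represent one flip; they share its rate equally. *)
Definition neighbor_rate s b v w : R :=
  if neighbor_rep s b v w then
    flip_rate P s w b /
      #|[set u | neighbor_rep s b v u & same_flip s w b u b]|%:R
  else 0.

Lemma flip_rate_ge0 s e c : 0 <= flip_rate P s e c.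
Proof. by rewrite /flip_rate; case: ifP => // _; exact: rate_ge0. Qed.

Lemma flip_rate_le s e c : flip_rate P s e c <= P #|cluster s e c|.
Proof. by rewrite /flip_rate; case: ifP => // _; exact: rate_ge0. Qed.

Lemma flip_probability_ge0 s e c : 0 <= flip_probability P s e c.
Proof. by rewrite flip_probabilityE divr_ge0 ?flip_rate_ge0. Qed.

Lemma flip_probability_le1 s e c : flip_probability P s e c <= 1.
Proof.
rewrite flip_probabilityE ler_pdivrMr ?ltr0n ?card_cluster_gt0 // mul1r.
apply: le_trans (flip_rate_le _ _ _) (le_trans (rate_le1 _ _) _).
by rewrite ler1n card_cluster_gt0.
Qed.

Lemma neighbor_rate_ge0 s b v w : 0 <= neighbor_rate s b v w.
Proof. by rewrite /neighbor_rate; case: ifP => // _; rewrite divr_ge0 ?flip_rate_ge0. Qed.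

Lemma neighbor_rate_le s b v w : neighbor_rate s b v w <= P #|cluster s w b|.
Proof.
rewrite /neighbor_rate; case: ifP => [wr|_]; last exact: rate_ge0.
apply: le_trans (flip_rate_le _ _ _).
rewrite ler_pdivrMr; last first.
  by rewrite ltr0n; apply/card_gt0P; exists w; rewrite inE wr same_flip_refl.
rewrite ler_peMr ?flip_rate_ge0 // ler1n; apply/card_gt0P; exists w.
by rewrite inE wr same_flip_refl.
Qed.

Lemma neighbor_rate_single s b v w :
  (forall u, adj v u -> color s u = color s w -> u = w) ->
  neighbor_rep s b v w -> neighbor_rate s b v w = flip_rate P s w b.
Proof.
move=> single wr; rewrite /neighbor_rate wr; set A := [set u | _].
suff -> : A = [set w] by rewrite cards1 divr1.
apply/setP => u; rewrite !inE; apply/andP/eqP => [[/and3P[vu ub _]]|->]; last first.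
  by rewrite same_flip_refl.
case/andP=> _; rewrite /opposite; case: (color s u =P _) => [uw _|_ /eqP bw].
  exact: single.
by case/and3P: wr; rewrite bw eqxx.
Qed.

Section Disagreement.
Variables (s t : coloring L) (v : edge E1 E2) (f : coloring L -> R).
Hypothesis st : forall e, e != v -> color s e = color t e.
Hypothesis stv : color s v != color t v.
Hypothesis fL : lipschitz 1 f.
Local Notation a := (color s v).
Local Notation b := (color t v).

Definition slack := weight v - (f s - f t).

Lemma slack_ge0 : 0 <= slack.
Proof.
rewrite /slack subr_ge0 -[leRHS]mul1r -weight_of1; apply: fL => e.
by rewrite inE => /st.
Qed.

(** The flipped coloring is compared with [t] instead of [s]: since [v] is in the cluster, they
    differ only there. *)
Lemma flip_center_gain c :
  gain f s v c <= slack + weight_rest s v c.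
Proof.
have : f (flip s v c) - f t <= 1 * weight_of (cluster s v c).
  apply: fL => e eC; rewrite (color_flip_out eC) st //.
  by apply: contraNneq eC => ->; exact: mem_cluster.
by rewrite mul1r weight_cluster /gain /slack; lra.
Qed.

Lemma gain_le u c : gain f s u c <= weight_of (cluster s u c).
Proof. by rewrite -[leRHS]mul1r; apply: fL => e /color_flip_out. Qed.

Lemma gain_ge u c : - gain f t u c <= weight_of (cluster t u c).
Proof.
rewrite opprB -[leRHS]mul1r; apply: fL => e eC; exact/esym/color_flip_out.
Qed.

(* The two flips are matched with weight [min p q]. *)
Lemma paired_gain w (p q : R) c d : 0 <= p -> 0 <= q ->
  p * gain f s w c - q * gain f t w d <=
    p * slack + (Num.max p q * weight w + p * weight_rest s w c + q * weight_rest t w d).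
Proof.
move=> p0 q0; have := gain_le w c; have := gain_ge w d; rewrite !weight_cluster.
(* The edge [w] lies in both clusters but its weight is counted once. *)
have joint : gain f s w c - gain f t w d <=
    slack + (weight w + weight_rest s w c + weight_rest t w d).
  have : f (flip s w c) - f (flip t w d) <=
      1 * weight_of (v |: (w |: ((cluster s w c :\ w) :|: (cluster t w d :\ w)))).
    apply: fL => e; rewrite !inE !negb_or.
    case/and3P=> ev ew; rewrite ew /= => /andP[es et].
    by rewrite !color_flip_out // st.
  rewrite mul1r => /le_trans/(_ (weight_ofU _ _)).
  have := weight_ofU [set w] ((cluster s w c :\ w) :|: (cluster t w d :\ w)).
  have := weight_ofU (cluster s w c :\ w) (cluster t w d :\ w).
  by rewrite !weight_of1 -!/(weight_rest _ _ _) /gain /slack; lra.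
set x := weight_rest s w c; set y := weight_rest t w d => gt gs.
have x0 : 0 <= x by exact: weight_rest_ge0.
have y0 : 0 <= y by exact: weight_rest_ge0.
have S0 := slack_ge0.
have [pq|/ltW qp] := leP p q.
  have := ler_wpM2l p0 joint.
  have qp0 : 0 <= q - p by rewrite subr_ge0.
  by have := ler_wpM2l qp0 gt; rewrite -/x -/y; nra.
have := ler_wpM2l q0 joint.
have qp0 : 0 <= p - q by rewrite subr_ge0.
by have := ler_wpM2l qp0 gs; rewrite -/x -/y; nra.
Qed.

(** A nontrivial cluster contains [v] and [w], so its rate is at most 137/2000. The factor 1/2 lets
    the terms of [s] and of [t] together use one slack. *)
Lemma center_gain_crude c w : adj v w -> color s w = c ->
  flip_rate P s v c * gain f s v c <= slack / 2 + 79/500.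
Proof.
move=> vw cw; have S0 := slack_ge0.
have [->|ca] := eqVneq c a.
  by rewrite /gain flip_trivial // subrr mulr0; lra.
have C2 : (1 < #|cluster s v c|)%N.
  rewrite (cardsD1 v) mem_cluster ltnS; apply/card_gt0P; exists w.
  rewrite !inE (adj_neq vw) /=; apply: (@cluster_center_subset _ _ _ _ s s v) => //.
apply: le_trans (ler_wpM2l (flip_rate_ge0 _ _ _) (flip_center_gain c)) _.
rewrite mulrDr; have := rate_rest (flip_rate_ge0 s v c) (flip_rate_le s v c).
have := ler_wpM2r S0 (le_trans (flip_rate_le s v c) (rate_le R C2)).
lra.
Qed.

(* The second alternative only arises for improper colorings: v and w then have
   the same color in t, and the cluster of w in t may contain v. *)
Lemma center_gain_single w : adj v w -> color s w \in L v ->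
  (forall u, adj v u -> color s u = color s w -> u = w) ->
  (exists2 q : R, 0 <= q /\ (q <= neighbor_rate t a v w) &
     q <= drop_rate R #|cluster t w a| /\
     flip_rate P s v (color s w) * gain f s v (color s w) -
       neighbor_rate t a v w * gain f t w a <= slack / 2 - q * gain f t w a) \/
  (color s w = b /\
     flip_rate P s v (color s w) * gain f s v (color s w) -
       neighbor_rate t a v w * gain f t w a <= slack / 2 + 79/500).
Proof.
move=> vw cL single; have S0 := slack_ge0.
have [ca|ca] := eqVneq (color s w) a.
  left; exists 0; first by rewrite neighbor_rate_ge0.
  rewrite drop_rate_ge0 ?card_cluster_gt0 //; split => //.
  rewrite ca /gain flip_trivial // subrr mulr0 /neighbor_rate /neighbor_rep.
  by rewrite -(st (adj_neq vw)) ca eqxx andbF /=; lra.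
have ts e : e != v -> color t e = color s e by move/st.
have wv := adj_neq vw.
have [vC|vC] := boolP (v \in cluster t w a).
  right; split.
    have := cluster_color vC; rewrite eq_sym -(st wv) => /orP[/eqP//|].
    by rewrite eq_sym (negbTE stv).
  have -> : neighbor_rate t a v w = 0 by rewrite /neighbor_rate /neighbor_rep vC !andbF.
  by rewrite mul0r subr0; exact: (center_gain_crude vw).
left; have rep : neighbor_rep t a v w by rewrite /neighbor_rep vw vC -(st wv) ca.
have singlet u : adj v u -> color t u = color t w -> u = w.
  by move=> vu; rewrite -!st ?(adj_neq vu) // => /(single _ vu).
have single' u : adj v u -> color t u = color s w -> u = w.
  by move=> vu; rewrite -st ?(adj_neq vu) // => /(single _ vu).
rewrite (neighbor_rate_single singlet rep) /flip_rate.
rewrite (flippable_center_single ts ca vw (esym (st wv)) single' vC cL).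
have [fl|_] := boolP (flippable t w a); last first.
  exists 0; rewrite ?lexx // drop_rate_ge0 ?card_cluster_gt0 //; split => //.
  by rewrite !mul0r; lra.
have Cv := cluster_center_single ts ca vw (esym (st wv)) single' vC.
have card : #|cluster s v (color s w)| = #|cluster t w a|.+1 by rewrite Cv cardsU1 vC.
(* The flip of [v] in [s] has rate [P_(i+1)], that of [w] in [t] rate [P_i]; the difference remains
   unmatched. *)
exists (drop_rate R #|cluster t w a|).
  by rewrite drop_rate_ge0 ?card_cluster_gt0 // /drop_rate lerBlDr lerDl rate_ge0.
split => //; rewrite card /drop_rate.
set q := P _.+1; set p := P #|cluster t w a|.
have q1 : q <= 1/2.
  have : q <= 137/2000 by apply: rate_le; rewrite ltnS card_cluster_gt0.
  lra.
have q0 : 0 <= q by exact: rate_ge0.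
(* The two matched flips produce colorings that can differ only at [v]. *)
have : gain f s v (color s w) - gain f t w a <= slack.
  have : f (flip s v (color s w)) - f (flip t w a) <= 1 * weight_of [set v].
    have fls : flippable s v (color s w).
      by rewrite (flippable_center_single ts ca vw (esym (st wv)) single' vC cL).
    apply: fL => e; rewrite inE => ev.
    rewrite !color_flip // /flipped_color Cv !inE (negbTE ev) /= -(st ev).
    case: ifP => // eC; rewrite -(st wv).
    have := cluster_color eC; rewrite -(st ev) -(st wv).
    have [->|] := eqVneq (color s e) a; first by rewrite eq_sym (negbTE ca).
    by rewrite orbF => _ /eqP->; rewrite eqxx.
  by rewrite weight_of1 /gain /slack; lra.
move=> /(ler_wpM2l q0); have := ler_wpM2r S0 q1; nra.
Qed.

End Disagreement.
End OneStep.

(** * Bound on the generator *)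

Section Contraction.
Variables (V : finType) (E1 E2 : {set {set V}}) (L : edge E1 E2 -> {fset nat}).
Variables (k : nat) (R : realType).
Hypothesis Lk : forall e, #|` L e| = k.
Implicit Types (s t : coloring L) (e u v w : edge E1 E2) (c d : nat).
Local Notation slot := (edge E1 E2 * 'I_k)%type.
Local Notation P := (rate R).
Local Notation weight := (weight R).

Lemma gain_opposite (f : coloring L -> R) s e d w : w \in cluster s e d ->
  gain f s w (opposite s e d w) = gain f s e d.
Proof. by move=> wC; rewrite /gain flip_opposite. Qed.

Definition generator (f : coloring L -> R) s : R :=
  \sum_(z : slot) flip_probability P s z.1 (slot_color L z) *
    gain f s z.1 (slot_color L z).

Section Split.
Variables (s t : coloring L) (v : edge E1 E2).
Hypothesis st : forall e, e != v -> color s e = color t e.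
Local Notation b := (color t v).

(** A cluster that contains [v] only in [t] reaches it through a neighbor of [v], which then
    represents the flip. *)
Lemma sum_detached (F : edge E1 E2 -> nat -> R) :
  (forall e d w, w \in cluster s e d -> F w (opposite s e d w) = F e d) ->
  \sum_(z : slot | (v \notin cluster s z.1 (slot_color L z)) &&
      (v \in cluster t z.1 (slot_color L z)))
    flip_probability P s z.1 (slot_color L z) * F z.1 (slot_color L z) =
  \sum_(w | adj v w) neighbor_rate R s b v w * F w b.
Proof.
move=> Finv.
rewrite (@cluster_orbit_sum _ _ _ _ _ _ _ Lk s _ (neighbor_rep s b v) id (fun=> b)) //.
- rewrite big_mkcond [RHS]big_mkcond; apply: eq_bigr => w _.
  rewrite /neighbor_rate; case: (boolP (neighbor_rep s b v w)) => [/and3P[-> _ _]//|_].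
  by rewrite mul0r if_same.
- move=> z /andP[vs vt] _; have zv : z.1 != v.
    by apply: contraNneq vs => <-; exact: mem_cluster.
  have [w vw [wC cw ow]] := cluster_disagree st zv vs vt.
  exists w; last by rewrite /same_flip wC ow eqxx.
  by rewrite /neighbor_rep vw cw -ow cluster_opposite.
move=> w z /and3P[vw cw vC] _ wz; move: (wz); rewrite same_flip_sym => /andP[wC /eqP ow].
have vz : v \notin cluster s z.1 (slot_color L z).
  by rewrite -(cluster_opposite wC) -ow.
by rewrite vz; apply: (neighbor_cluster_sub st vz wC vw cw).
Qed.

Lemma generator_split f : generator f s =
  \sum_(z : slot | (v \notin cluster s z.1 (slot_color L z)) &&
      (v \notin cluster t z.1 (slot_color L z)))
    flip_probability P s z.1 (slot_color L z) * gain f s z.1 (slot_color L z) +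
  (\sum_(i < k) flip_rate P s v (nth_color L v i) * gain f s v (nth_color L v i) +
   \sum_(w | adj v w) neighbor_rate R s b v w * gain f s w b).
Proof.
have gO : forall e d w, w \in cluster s e d ->
    gain f s w (opposite s e d w) = gain f s e d by exact: gain_opposite.
rewrite /generator (bigID (fun z : slot => v \in cluster s z.1 (slot_color L z))) /=.
rewrite [X in _ + X](bigID (fun z : slot => v \in cluster t z.1 (slot_color L z))) /=.
rewrite sum_detached // [LHS]addrA [LHS]addrC; congr (_ + (_ + _)).
rewrite (@cluster_orbit_sum _ _ _ _ _ _ _ Lk s _ predT (fun=> v) (fun i : 'I_k => nth_color L v i)) //=.
- apply: eq_bigr => i _; set A := [set j | _].
  suff -> : A = [set i] by rewrite cards1 divr1.
  apply/setP => j; rewrite !inE /same_flip mem_cluster /opposite eqxx /=.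
  exact/(inj_eq (nth_color_inj Lk (e := v))).
- move=> z vz fl; have [i vi] := nth_color_surj Lk (flippable_opposite_in fl vz).
  by exists i; rewrite // /same_flip vz vi eqxx.
by move=> i z _ _; rewrite same_flip_sym => /andP[].
Qed.

Lemma sum_neighbor_rate : \sum_(w | adj v w) neighbor_rate R s b v w <=
  #|[set z : slot | (v \notin cluster s z.1 (slot_color L z)) &&
      (v \in cluster t z.1 (slot_color L z))]|%:R.
Proof.
have := sum_detached (F := fun _ _ => 1) (fun _ _ _ _ => erefl).
under [X in _ = X]eq_bigr do rewrite mulr1; move=> <-.
rewrite -sum1_card natr_sum; under [leRHS]eq_bigl do rewrite inE.
by apply: ler_sum => z _; rewrite mulr1 flip_probability_le1.
Qed.

End Split.

(* What a neighbor w of v may cost: [sum_budget] compares the total with k * weight v. *)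
Definition budget v w : R :=
  if shared v then 3043/1000 * (1 + (shared w)%:R) else 743/250.

(** The constants of [budget] come from here: equality holds if only [v] is shared, and if only [w]
    is shared the left side is 2.971075 against 2.972. *)
Lemma budget_single v w :
  weight v + (1863/2000 * weight w + 123/2000) <= budget v w.
Proof. by rewrite /budget /weight; case: (shared v); case: (shared w) => /=; lra. Qed.

(** The halved term is a surplus: two neighbors of one color together pay for [weight v] and for the
    unmatched flips of [v]. *)
Lemma budget_many v w :
  weight w + 79/500 + (weight v + 79/250) / 2 <= budget v w.
Proof. by rewrite /budget /weight; case: (shared v); case: (shared w) => /=; lra. Qed.

Lemma lipschitzN (f : coloring L -> R) K : lipschitz K f -> lipschitz K (\- f).
Proof.
move=> fL s t S st; rewrite opprK addrC; apply: fL => e eS; exact/esym/st.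
Qed.

Lemma gainN (f : coloring L -> R) s e c : gain (\- f) s e c = - gain f s e c.
Proof. by rewrite /gain /= opprB opprK addrC. Qed.

Section Bound.
Variables (s t : coloring L) (v : edge E1 E2) (f : coloring L -> R).
Hypothesis st : forall e, e != v -> color s e = color t e.
Hypothesis stv : color s v != color t v.
Hypothesis fL : lipschitz 1 f.
Local Notation a := (color s v).
Local Notation b := (color t v).
Local Notation slk := (slack s t v f).

Let ts e : e != v -> color t e = color s e. Proof. by move/st. Qed.
Let tsv : color t v != color s v. Proof. by rewrite eq_sym. Qed.

(** Exchanging [s] and [t] while negating [f] preserves the slack, so one-sided bounds for [s]
    transfer to [t]. *)
Let slackN : slack t s v (\- f) = slk.
Proof. by rewrite /slack /= opprK [- f t + _]addrC. Qed.

Definition center_term c :=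
  flip_rate P s v c * gain f s v c - flip_rate P t v c * gain f t v c.

Definition neighbor_term w :=
  neighbor_rate R s b v w * gain f s w b - neighbor_rate R t a v w * gain f t w a.

(** The cost of [w] beyond its slack and its budget. It is never positive, and what is left of the
    budget serves the center term of the color of [w]. *)
Definition excess w := neighbor_term w - neighbor_rate R s b v w * slk - budget v w.

Lemma neighbor_term_le w :
  neighbor_term w <= neighbor_rate R s b v w * slk + (weight w + 79/500).
Proof.
apply: le_trans (paired_gain st fL w b a (neighbor_rate_ge0 _ _ _ _ _)
  (neighbor_rate_ge0 _ _ _ _ _)) _.
rewrite lerD2l; apply: rate_pair; rewrite ?neighbor_rate_ge0 ?neighbor_rate_le //.
Qed.

Lemma excess_le w : excess w <= - ((weight v + 79/250) / 2).
Proof. by have := neighbor_term_le w; have := budget_many v w; rewrite /excess; lra. Qed.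

Lemma excess_le0 w : excess w <= 0.
Proof. by apply: le_trans (excess_le w) _; have := weight_ge1 R v; lra. Qed.

(** Both clusters are [[set v]] and flipped at rate 1, and the two flips yield the same coloring. *)
Lemma center_term_free c : c \in L v -> (forall w, adj v w -> color s w != c) ->
  center_term c = slk - weight v.
Proof.
move=> cL free; have free' w : adj v w -> color t w != c.
  by move=> vw; rewrite -(st (adj_neq vw)) free.
have Cs : cluster s v c = [set v] by exact: (cluster_center_free (s := s)).
have Ct : cluster t v c = [set v] by exact: (cluster_center_free (s := s)).
have fls : flippable s v c.
  by apply/forall_inP => w; rewrite Cs inE => /eqP->; rewrite color_in.
have flt : flippable t v c.
  by apply/forall_inP => w; rewrite Ct inE => /eqP->; rewrite color_in.
rewrite /center_term /flip_rate fls flt Cs Ct cards1.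
have fE : flip s v c = flip t v c.
  apply: color_inj => e; rewrite !color_flip // /flipped_color Cs Ct inE.
  by have [->|/st] := eqVneq e v; rewrite ?eqxx.
have -> : P 1 = 1 by [].
by rewrite /gain fE /slack; lra.
Qed.

Lemma center_term_single w : adj v w -> color s w \in L v ->
  (forall u, adj v u -> color s u = color s w -> u = w) ->
  center_term (color s w) + excess w <= slk - weight v.
Proof.
move=> vw cL single; have wv := adj_neq vw; have stw := st wv.
have S0 := slack_ge0 st fL; have w1 := weight_ge1 R w.
have single' u : adj v u -> color t u = color t w -> u = w.
  by move=> vu; rewrite -!st ?(adj_neq vu) // => /(single _ vu).
have cL' : color t w \in L v by rewrite -stw.
have half := center_gain_single st stv fL vw cL single.
have half' := center_gain_single ts tsv (lipschitzN fL) vw cL' single'.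
have ns0 := neighbor_rate_ge0 R s b v w; have := budget_single v w.
have nsS : 0 <= neighbor_rate R s b v w * slk by rewrite mulr_ge0.
rewrite /excess /center_term /neighbor_term.
move: half half'; rewrite !gainN slackN -stw !mulrN.
set X := flip_rate P s v _ * _; set X' := neighbor_rate R t a v w * _.
set Y := flip_rate P t v _ * _; set Y' := neighbor_rate R s b v w * gain f s w b.
have same d : color s w = d -> d = a -> X = 0 /\ X' = 0.
  move=> wd da; rewrite /X /X' wd da /gain flip_trivial // subrr mulr0.
  by rewrite /neighbor_rate /neighbor_rep -stw wd da eqxx andbF mul0r.
have same' d : color s w = d -> d = b -> Y = 0 /\ Y' = 0.
  move=> wd da; rewrite /Y /Y' wd da /gain flip_trivial // subrr mulr0.
  by rewrite /neighbor_rate /neighbor_rep wd da eqxx andbF mul0r.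
(* In the second alternative, for either coloring, the terms of the other one are trivial moves and
   vanish; the budget covers 79/500. *)
case=> [[q [q0 qn] [qd hq]]|[wb h]]; last first.
  by move=> _; have [] := same' _ wb erefl => -> ->; lra.
case=> [[q' [q'0 q'n] [q'd hq']]|[wa h]]; last first.
  by have [] := same _ wa erefl => -> ->; lra.
(* The rates of [w] left over in the two colorings are matched with each other. *)
have := paired_gain st fL w b a q'0 q0.
have := drop_rate_pair q'0 q0 q'd qd.
have := ler_wpM2r S0 q'n.
lra.
Qed.

Lemma center_term_crude c w : adj v w -> color s w = c -> center_term c <= slk + 79/250.
Proof.
move=> vw cw; have cw' : color t w = c by rewrite -(st (adj_neq vw)).
have := center_gain_crude st fL vw cw.
have := center_gain_crude ts (lipschitzN fL) vw cw'.
by rewrite slackN gainN /center_term mulrN; lra.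
Qed.

Lemma color_class_bound c : c \in L v ->
  center_term c + \sum_(w | adj v w && (color s w == c)) excess w <= slk - weight v.
Proof.
move=> cL; case: (pickP [pred w | adj v w && (color s w == c)]) => [w /= wc|none].
  case: (pickP [pred u | (adj v u && (color s u == c)) && (u != w)]) => [u /= uc|sole].
    (* The surplus of two neighbors suffices; any others only help. *)
    rewrite (bigD1 w) //= (bigD1 u) //=.
    have : \sum_(i | adj v i && (color s i == c) && (i != w) && (i != u)) excess i <= 0.
      by apply: sumr_le0 => i _; exact: excess_le0.
    case/andP: wc => vw /eqP cw.
    by have := excess_le w; have := excess_le u; have := center_term_crude vw cw; lra.
  case/andP: (wc) => vw /eqP cw; rewrite (big_pred1 w) -?cw; last first.
    move=> u /=; apply/idP/eqP => [uc|->]; last by rewrite vw eqxx.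
    by have := sole u; rewrite /= -cw uc /= => /negbFE/eqP.
  apply: center_term_single; rewrite ?cw // => u vu cu; apply/eqP.
  by have := sole u; rewrite /= vu cu eqxx /= => /negbFE.
rewrite big_pred0; last by move=> w; have := none w.
rewrite addr0 center_term_free // => w vw.
by apply/negP => cw; have := none w; rewrite /= vw cw.
Qed.

(** Neighbors whose color is not in [L v] belong to no class; dropping them only raises the sum, as
    their excess is not positive. *)
Lemma excess_color_classes :
  \sum_(w | adj v w) excess w <=
  \sum_(i < k) \sum_(w | adj v w && (color s w == nth_color L v i)) excess w.
Proof.
rewrite (exchange_big_dep [pred w | adj v w]) /=; last by move=> i w _ /andP[].
apply: ler_sum => w vw; rewrite vw /=.
have [/(nth_color_surj Lk)[i wi]|nw] := boolP (color s w \in L v).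
  rewrite (big_pred1 i) // => j /=; rewrite -wi eq_sym.
  exact: (inj_eq (nth_color_inj Lk (e := v))).
rewrite big_pred0 ?excess_le0 // => i; apply: contraNF nw => /eqP->.
exact: nth_color_in.
Qed.

(* The coefficient of the slack is at most the number of moves: a move whose cluster
   avoids v in both colorings contributes at most one slack, the moves at v one each,
   and the matched neighbors at most the probability of the remaining moves. *)
Lemma generator_diff : generator f s - generator f t <=
  (#|edge E1 E2| * k)%:R * slk + \sum_(w | adj v w) budget v w - k%:R * weight v.
Proof.
have S0 := slack_ge0 st fL.
pose Ns (z : slot) := v \notin cluster s z.1 (slot_color L z).
pose Nt (z : slot) := v \notin cluster t z.1 (slot_color L z).
rewrite (generator_split st) (generator_split ts).
set As := \sum_(z : slot | _) _; set At := \sum_(z : slot | _) _.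
(* Such a move selects the same cluster in both colorings, so the flipped colorings can differ only
   at [v]. *)
have dA : As - At <= \sum_(z : slot | Ns z && Nt z) slk.
  rewrite /As /At [X in _ - X](eq_bigl (fun z => Ns z && Nt z)); last first.
    by move=> z; rewrite andbC.
  rewrite -sumrB; apply: ler_sum => z /andP[zs zt].
  have Cst := cluster_eq st zs zt; have zv : z.1 != v.
    by apply: contraNneq zs => <-; exact: mem_cluster.
  have fst : flippable t z.1 (slot_color L z) = flippable s z.1 (slot_color L z).
    by rewrite /flippable Cst (st zv).
  have := flip_probability_ge0 R s z.1 (slot_color L z).
  have := flip_probability_le1 R s z.1 (slot_color L z).
  have -> : flip_probability P t z.1 (slot_color L z) =
      flip_probability P s z.1 (slot_color L z).
    by rewrite /flip_probability fst Cst.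
  rewrite -mulrBr /flip_probability -fst; case: ifP => [flt|_] p1 p0; last by rewrite mul0r.
  have fls : flippable s z.1 (slot_color L z) by rewrite -fst.
  have gd : gain f s z.1 (slot_color L z) - gain f t z.1 (slot_color L z) <= slk.
    have : f (flip s z.1 (slot_color L z)) - f (flip t z.1 (slot_color L z)) <=
        1 * weight_of R [set v].
      apply: fL => e; rewrite inE => ev; rewrite !color_flip // /flipped_color Cst.
      by rewrite !(st ev) (st zv).
    by rewrite weight_of1 /gain /slack; lra.
  by apply: le_trans (ler_wpM2l p0 gd) _; rewrite ler_piMl.
have cnt : \sum_(z : slot | Ns z && Nt z) slk + k%:R * slk +
    \sum_(w | adj v w) neighbor_rate R s b v w * slk <=
    (#|edge E1 E2| * k)%:R * slk.
  rewrite sumr_const -mulr_suml -[slk *+ _]mulr_natl -!mulrDl ler_wpM2r //.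
  have := sum_neighbor_rate st; set r := \sum_(w | _) _ => rle.
  apply: le_trans (lerD (lexx _) rle) _; rewrite -!natrD ler_nat.
  have -> : (#|edge E1 E2| * k)%N = #|{: slot}| by rewrite card_prod card_ord.
  have -> : #|[pred z | Ns z && Nt z]| = #|[set z : slot | Ns z && Nt z]|.
    by apply: eq_card => z; rewrite !inE.
  have kle : (k <= #|[set z : slot | ~~ Ns z]|)%N.
    rewrite -[k in (k <= _)%N]card_ord -(card_imset predT (f := fun i : 'I_k => (v, i))); last first.
      by move=> i j [].
    apply: subset_leq_card; apply/fintype.subsetP => z /imsetP[i _ ->].
    by rewrite inE negbK mem_cluster.
  have -> : #|{: slot}| = (#|[set z : slot | Ns z && Nt z]| + #|[set z : slot | ~~ Ns z]|
      + #|[set z : slot | Ns z && ~~ Nt z]|)%N.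
    rewrite -(cardsC [set z : slot | ~~ Ns z]) [RHS]addnAC [LHS]addnC; congr (_ + _)%N.
    rewrite -(cardsID [set z : slot | Nt z]); congr (_ + _)%N; apply: eq_card => z;
      by rewrite !inE negbK // andbC.
  rewrite -!addnA leq_add2l; apply: leq_add => //.
  by apply: subset_leq_card; apply/fintype.subsetP => z; rewrite !inE negbK.
have cls : \sum_(i < k) center_term (nth_color L v i) + \sum_(w | adj v w) excess w <=
    k%:R * (slk - weight v).
  apply: le_trans (lerD (lexx _) excess_color_classes) _.
  rewrite -big_split /= mulr_natl -[X in _ *+ X]card_ord -sumr_const; apply: ler_sum => i _.
  exact: color_class_bound (nth_color_in _ _ _).
move: cls; rewrite /center_term /excess /neighbor_term !sumrB.
set Bs := \sum_(i < k) flip_rate P s v _ * _; set Bt := \sum_(i < k) _.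
lra.
Qed.

End Bound.
End Contraction.

(** * The transition operator on functions *)

Section Mean.
Variables (R : realType) (T : finType) (K : T -> T -> R).

Definition mean (f : T -> R) x := \sum_y K x y * f y.

Lemma sum_delta (f : T -> R) x : \sum_y (y == x)%:R * f y = f x.
Proof.
rewrite (bigD1 x) //= eqxx mul1r big1 ?addr0 // => y yx.
by rewrite (negbTE yx) mul0r.
Qed.

Lemma sum_iter_kernel t (f : T -> R) x :
  \sum_y iter_kernel K t x y * f y = iter t mean f x.
Proof.
elim: t f => [|t IH] f; first exact: sum_delta.
rewrite iterSr -IH /mean /=; under eq_bigr do rewrite mulr_suml.
rewrite exchange_big /=; apply: eq_bigr => z _; rewrite mulr_sumr.
by apply: eq_bigr => y _; rewrite mulrA.
Qed.

End Mean.

(** * Counting incidences *)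

Section Degrees.
Variables (V : finType) (E1 E2 : {set {set V}}).

Lemma card_incident (E : {set {set V}}) (Delta : nat) (v : edge E1 E2) :
  (max_degree E <= Delta)%N ->
  (#|[set w : edge E1 E2 | (val w \in E) && ~~ [disjoint val v & val w]]| <=
     #|val v| * Delta)%N.
Proof.
move=> dE; pose A x := [set w : edge E1 E2 | (val w \in E) && (x \in val w)].
apply: (@leq_trans (\sum_(x in val v) #|A x|)).
  under [leqRHS]eq_bigr do rewrite -sum1_card.
  rewrite (exchange_big_dep predT) //= -sum1_card [leqLHS]big_mkcond.
  apply: leq_sum => w _; rewrite inE; case: ifP => // /andP[wE].
  rewrite -setI_eq0 => /finset.set0Pn[x /setIP[xv xw]].
  by rewrite (bigD1 x) // xv inE wE.
rewrite -sum_nat_const; apply: leq_sum => x _.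
apply: leq_trans dE; apply: leq_trans (leq_bigmax x).
rewrite -(card_imset _ (@val_inj _ _ (edge E1 E2))); apply: subset_leq_card.
by apply/fintype.subsetP => e /imsetP[w]; rewrite !inE => wE ->.
Qed.

Variables (R : realType) (k Delta : nat).
Hypotheses (simple1 : simple_graph E1) (simple2 : simple_graph E2).
Hypotheses (deg1 : (max_degree E1 <= Delta)%N) (deg2 : (max_degree E2 <= Delta)%N).
Hypothesis kD : (5 + 948%:R / 1000%:R) * Delta%:R <= k%:R :> R.

Lemma card_edge (v : edge E1 E2) : #|val v| = 2%N.
Proof. by have := valP v; rewrite inE => /orP[/simple1|/simple2]. Qed.

(** In units of [Delta]: for a shared edge 4 * 3.043 = 12.172 is below 5.948 * 2.05 = 12.1934, and
    otherwise 2 * 2.972 = 5.944 is below 5.948. Both gaps leave room for the factor 1 - 1/2000. *)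
Lemma sum_budget (v : edge E1 E2) :
  \sum_(w | adj v w) budget R v w <= (1 - 2000^-1) * (k%:R * weight R v).
Proof.
have i1 := card_incident v deg1; have i2 := card_incident v deg2.
rewrite card_edge in i1 i2.
set A1 := [set w | _] in i1; set A2 := [set w | _] in i2.
have b1 : #|A1|%:R <= 2 * Delta%:R :> R by rewrite -natrM ler_nat.
have b2 : #|A2|%:R <= 2 * Delta%:R :> R by rewrite -natrM ler_nat.
have D0 : 0 <= Delta%:R :> R by [].
have kD' : 1487/250 * Delta%:R <= k%:R :> R.
  by apply: le_trans kD; rewrite ler_wpM2r //; lra.
have card (A : {set edge E1 E2}) : #|A|%:R = \sum_(w : edge E1 E2) (w \in A)%:R :> R.
  rewrite -sum1_card natr_sum big_mkcond; apply: eq_bigr => w _.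
  by case: (w \in A).
have sumA (c : R) (A : {set edge E1 E2}) : (forall w, adj v w -> w \in A) ->
    \sum_(w | adj v w) c <= `|c| * #|A|%:R.
  move=> adjA; rewrite card mulr_sumr big_mkcond; apply: ler_sum => w _.
  case: ifP => [/adjA->|_]; last by rewrite mulr_ge0.
  by rewrite mulr1 ler_norm.
have := valP v; rewrite inE; case: (boolP (val v \in E1)) => v1.
  case: (boolP (val v \in E2)) => v2 _.
    have vs : shared v by rewrite /shared v1 v2.
    (* The budget counts [w] once for each of the two graphs it lies in. *)
    have : \sum_(w | adj v w) budget R v w <= 3043/1000 * (#|A1|%:R + #|A2|%:R).
      rewrite !card -big_split /= mulr_sumr big_mkcond; apply: ler_sum => w _.
      rewrite /budget vs /shared !inE /adj v1 v2 /=.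
      case: (boolP [disjoint val v & val w]) => dj; rewrite ?andbF ?andbT /=.
        by rewrite addr0 mulr0.
      by case: (val w \in E1); case: (val w \in E2); case: (v != w) => /=; lra.
    by rewrite /weight vs; lra.
  have vs : shared v = false by rewrite /shared (negbTE v2) andbF.
  rewrite (eq_bigr (fun=> 743/250)); last by move=> w _; rewrite /budget vs.
  have := sumA (743/250) A1; rewrite ger0_norm /weight ?vs; last by lra.
  move=> /(_ _)/le_trans; apply; last by lra.
  by move=> w; rewrite /adj v1 (negbTE v2) orbF /= inE => /and3P[_ -> ->].
move=> /= v2; have vs : shared v = false by rewrite /shared (negbTE v1).
rewrite (eq_bigr (fun=> 743/250)); last by move=> w _; rewrite /budget vs.
have := sumA (743/250) A2; rewrite ger0_norm /weight ?vs; last by lra.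
move=> /(_ _)/le_trans; apply; last by lra.
by move=> w; rewrite /adj v2 (negbTE v1) /= inE => /and3P[_ -> ->].
Qed.

Lemma card_edges_le : (#|edge E1 E2| <= #|V| ^ 2)%N.
Proof.
rewrite card_sig; apply: (@leq_trans #|[set A : {set V} | #|A| == 2]|).
  apply: subset_leq_card; apply/fintype.subsetP => A; rewrite !inE.
  by case/orP => [/simple1|/simple2] ->.
rewrite card_draws bin2 (leq_trans (half_leq (leq_mul (leqnn _) (leq_pred _)))) //.
by rewrite -mulnn -{2}[(_ * _)%N]half_double half_leq // -addnn leq_addr.
Qed.

End Degrees.

(** * From contraction to mixing *)

Section Mixing.
Variables (V : finType) (E1 E2 : {set {set V}}) (L : edge E1 E2 -> {fset nat}).
Variables (R : realType) (k Delta : nat).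
Hypothesis Lk : forall e, #|` L e| = k.
Hypotheses (simple1 : simple_graph E1) (simple2 : simple_graph E2).
Hypotheses (deg1 : (max_degree E1 <= Delta)%N) (deg2 : (max_degree E2 <= Delta)%N).
Hypothesis k_gt0 : (0 < k)%N.
Hypothesis kD : (5 + 948%:R / 1000%:R) * Delta%:R <= k%:R :> R.
Local Notation K := (flip_dynamics L k (rate R)).
Local Notation m := #|edge E1 E2|.

Lemma mean_flip_dynamics (f : coloring L -> R) s :
  mean K f s = f s + (m * k)%:R^-1 * generator k f s.
Proof.
have Ep (G : edge E1 E2 -> 'I_k -> R) :
    \sum_e \sum_i G e i = \sum_(z : edge E1 E2 * 'I_k) G z.1 z.2.
  by rewrite pair_bigA.
rewrite /mean /flip_dynamics; under eq_bigr do rewrite mulrDl.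
rewrite big_split /=; under [X in _ + X]eq_bigr do rewrite -mulrA.
rewrite -mulr_sumr sum_delta !Ep mulrBl mul1r.
under eq_bigr do rewrite Ep mulr_suml.
rewrite exchange_big /= addrCA; congr (_ + _).
rewrite /generator mulr_sumr mulr_suml -sumrB; apply: eq_bigr => z _.
under eq_bigr do rewrite -mulrA.
by rewrite -mulr_sumr sum_delta -mulrBr -mulrA.
Qed.

Lemma sum_proper_mean (f : coloring L -> R) :
  \sum_(s in proper_colorings L) mean K f s = \sum_(s in proper_colorings L) f s.
Proof.
under eq_bigr do rewrite mean_flip_dynamics.
by rewrite big_split /= -mulr_sumr (sum_proper_gain _ Lk) mulr0 addr0.
Qed.

Definition contraction : R := 1 - (2000 * m%:R)^-1.

Lemma contraction_gt0 : 0 < contraction.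
Proof.
(* For [m = 0] the inverse is 0 by convention and the factor is 1. *)
rewrite /contraction subr_gt0; have [->|m0] := posnP m; first by rewrite mulr0 invr0.
have m1 : 1 <= m%:R :> R by rewrite ler1n.
by rewrite invf_lt1; lra.
Qed.

Lemma contraction_adjacent (f : coloring L -> R) s t v :
  (forall e, e != v -> color s e = color t e) -> color s v != color t v ->
  lipschitz 1 f -> mean K f s - mean K f t <= contraction * weight R v.
Proof.
move=> st stv fL; rewrite !mean_flip_dynamics.
have m0 : (0 < m)%N by apply/card_gt0P; exists v.
have := generator_diff Lk st stv fL.
have := sum_budget simple1 simple2 deg1 deg2 kD v.
set B := \sum_(w | _) _; set Hs := generator k f s; set Ht := generator k f t.
set W := weight R v; move=> Ble gen.
have mk : 0 < (m * k)%:R :> R by rewrite ltr0n muln_gt0 m0.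
(* The slack completes [f s - f t] to [weight v]; the 1/2000 spared by [sum_budget], divided by [m],
   is the contraction. *)
have : (m * k)%:R^-1 * (Hs - Ht) <= slack s t v f - (2000 * m%:R)^-1 * W.
  rewrite mulrC ler_pdivrMr //; apply: le_trans gen _.
  have -> : (slack s t v f - (2000 * m%:R)^-1 * W) * (m * k)%:R =
      (m * k)%:R * slack s t v f - 2000^-1 * (k%:R * W).
    rewrite natrM; field; rewrite pnatr_eq0 -lt0n m0 //.
  lra.
rewrite /slack /contraction -/W mulrBr mulrBl mul1r; lra.
Qed.

(** Path coupling: [s] is turned into [t] one edge at a time. Intermediate colorings may be
    improper, hence the bound for all colorings. *)
Lemma contraction1 (f : coloring L -> R) :
  lipschitz 1 f -> lipschitz contraction (mean K f).
Proof.
move=> fL s t S; have [n] := ubnP #|S|; elim: n S s => // n IH S s Sn st.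
have [S0|[v vS]] := set_0Vmem S.
  have -> : s = t by apply: color_inj => e; rewrite st // S0 inE.
  by rewrite subrr mulr_ge0 ?weight_of_ge0 // ltW ?contraction_gt0.
pose s' : coloring L := [ffun w => if w == v then t w else s w].
have s'v : color s' v = color t v by rewrite /color ffunE eqxx.
have s's e : e != v -> color s e = color s' e by move=> ev; rewrite /color ffunE (negbTE ev).
have : mean K f s' - mean K f t <= contraction * weight_of R (S :\ v).
  apply: IH => [|e]; first by move: Sn; rewrite (cardsD1 v) vS.
  have [->//|ev] := eqVneq e v.
  by rewrite in_setD1 ev /= => eS; rewrite -s's // st.
have : mean K f s - mean K f s' <= contraction * weight R v.
  have [sv|sv] := eqVneq (color s v) (color t v).
    have -> : s' = s.
      by apply: color_inj => e; have [->|/s's//] := eqVneq e v; rewrite s'v.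
    by rewrite subrr mulr_ge0 ?weight_ge0 // ltW ?contraction_gt0.
  by apply: contraction_adjacent; rewrite ?s'v.
rewrite (weight_ofD1 _ vS); lra.
Qed.

Lemma contractionM C (f : coloring L -> R) : 0 < C ->
  lipschitz C f -> lipschitz (contraction * C) (mean K f).
Proof.
move=> C0 fL; pose g s := C^-1 * f s.
have gL : lipschitz 1 g.
  by move=> s t S st; rewrite -mulrBr mulrC ler_pdivrMr // mul1r mulrC fL.
have fg : mean K f =1 fun s => C * mean K g s.
  move=> s; rewrite /mean mulr_sumr; apply: eq_bigr => t _.
  by rewrite /g mulrCA mulVKf ?gt_eqF.
move=> s t S st; rewrite !fg -mulrBr mulrAC mulrC ler_wpM2r ?(ltW C0) //.
exact: contraction1.
Qed.

Lemma contraction_iter C (f : coloring L -> R) n : 0 < C ->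
  lipschitz C f -> lipschitz (contraction ^+ n * C) (iter n (mean K) f).
Proof.
move=> C0 fL; elim: n => [|n IH]; first by rewrite expr0 mul1r.
rewrite exprS -mulrA iterS; apply: contractionM => //.
by rewrite mulr_gt0 ?exprn_gt0 ?contraction_gt0.
Qed.

(** The distance is half the difference of two expectations of a sign function. By stationarity the
    second is the average of the iterates over proper colorings, and two colorings are at weighted
    distance at most [41/20 * m]. *)
Lemma tv_dist_le s n : s \in proper_colorings L ->
  tv_dist (iter_kernel K n s) (uniform_on R (proper_colorings L)) <=
    contraction ^+ n * (41/20 * m%:R).
Proof.
move=> sP; set A := proper_colorings L; set mu := iter_kernel K n s.
set pi := uniform_on R A.
pose f y : R := if 0 <= mu y - pi y then 1 else -1.
(* The values are 1 and -1, and every edge weighs at least 1. *)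
have fL : lipschitz 2 f.
  move=> x y S xy; have [S0|[e eS]] := set_0Vmem S.
    have -> : x = y by apply: color_inj => e; rewrite xy // S0 inE.
    by rewrite subrr mulr_ge0 ?weight_of_ge0.
  have := weight_ge1 R e; have := weight_of_ge0 R (S :\ e).
  by rewrite (weight_ofD1 _ eS) /f; case: ifP => _; case: ifP => _; lra.
have A0 : (0 < #|A|)%N by apply/card_gt0P; exists s.
have A0' : #|A|%:R != 0 :> R by rewrite pnatr_eq0 -lt0n.
have pif g : \sum_y pi y * g y = #|A|%:R^-1 * \sum_(y in A) g y.
  rewrite mulr_sumr [RHS]big_mkcond; apply: eq_bigr => y _; rewrite /pi /uniform_on.
  by case: ifP => _; rewrite ?mul0r.
have stat j g : \sum_(y in A) iter j (mean K) g y = \sum_(y in A) g y.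
  by elim: j => //= j IH; rewrite sum_proper_mean.
have -> : tv_dist mu pi = 2^-1 * (\sum_y mu y * f y - \sum_y pi y * f y).
  rewrite /tv_dist -sumrB; congr (_ * _); apply: eq_bigr => y _.
  rewrite -mulrBl /f; case: ifP => [h|/negbT]; first by rewrite mulr1 ger0_norm.
  by rewrite -ltNge => h; rewrite mulrN1 ltr0_norm.
rewrite sum_iter_kernel pif -(stat n).
have -> : iter n (mean K) f s = #|A|%:R^-1 * \sum_(y in A) iter n (mean K) f s.
  by rewrite sumr_const -[X in _ * X]mulr_natl mulKf.
rewrite -mulrBr -sumrB.
have c0 : 0 <= contraction ^+ n by rewrite exprn_ge0 ?ltW ?contraction_gt0.
have : \sum_(y in A) (iter n (mean K) f s - iter n (mean K) f y) <=
    \sum_(y in A) contraction ^+ n * 2 * (41/20 * m%:R).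
  apply: ler_sum => y _.
  have fnL := contraction_iter n (ltr0Sn _ 1) fL.
  apply: le_trans (fnL s y [set: _] _) _; first by move=> e; rewrite inE.
  rewrite ler_wpM2l ?mulr_ge0 //.
  by apply: le_trans (weight_of_card _ _) _; rewrite cardsT.
rewrite sumr_const -[leRHS]mulr_natl; set X := \sum_(y in A) _ => Xle.
have Ai : 0 <= #|A|%:R^-1 :> R by rewrite invr_ge0.
have := ler_wpM2l Ai Xle; rewrite mulKf //; lra.
Qed.

Lemma mixing_time_le n :
  contraction ^+ n * (41/20 * m%:R) <= 4^-1 ->
  (mixing_time K (proper_colorings L) <= (n%:R)%:E)%E.
Proof.
move=> hn; rewrite /mixing_time; apply: (big_ind (fun x => (x <= n%:R%:E)%E)) => [|x y xn yn|s sP].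
- by rewrite lee_fin.
- by rewrite ge_max xn yn.
by apply: ereal_inf_lbound; exists n => //=; apply: le_trans hn; exact: tv_dist_le.
Qed.

(** This uses [1 - x <= exp (- x)]; the 9 rounds up 4 * 41/20 = 8.2. *)
Lemma contraction_exp n : (0 < m)%N ->
  2000 * m%:R * ln (9 * m%:R) <= n%:R :> R -> contraction ^+ n * (41/20 * m%:R) <= 4^-1.
Proof.
move=> m0 hn; have m0' : 0 < m%:R :> R by rewrite ltr0n.
have m9 : 0 < 9 * m%:R :> R by rewrite mulr_gt0.
have : contraction ^+ n <= (9 * m%:R)^-1.
  rewrite -[9 * _]lnK ?posrE // -expRN.
  apply: (@le_trans _ _ (expR (- (2000 * m%:R)^-1) ^+ n)).
    rewrite lerXn2r ?nnegrE ?expR_ge0 ?(ltW contraction_gt0) //.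
    exact: expR_ge1Dx.
  have x0 : 0 < 2000 * m%:R :> R by lra.
  rewrite -expRM_natl ler_expR mulrN lerN2; move: hn x0.
  by set x := 2000 * m%:R => hn x0; rewrite ler_pdivlMr // mulrC.
have c0 : 0 <= 41/20 * m%:R :> R by lra.
move=> /(ler_wpM2r c0)/le_trans; apply.
rewrite invfM; have -> : 9^-1 * m%:R^-1 * (41/20 * m%:R) = 41/180 :> R.
  by field; rewrite gt_eqF.
lra.
Qed.

End Mixing.

(** * The mixing time bound *)

Lemma ln2_ge_half (R : realType) : 1/2 <= ln 2 :> R.
Proof.
rewrite -ler_expR lnK ?posrE //; have := expR_ge1Dx (- (1/2) : R).
rewrite expRN => h; have e0 := expR_gt0 (1/2 : R).
have := ler_wpM2r (ltW e0) h; rewrite mulVf ?gt_eqF //; lra.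
Qed.

Theorem theorem7p1 (R : realType) :
  exists C : R,
  forall (n Delta : nat) (V : finType) (E1 E2 : {set {set V}}) (k : nat)
         (L : edge E1 E2 -> {fset nat}),
    (1 <= n)%N -> (1 <= Delta)%N ->
    #|V| = n ->
    simple_graph E1 -> simple_graph E2 ->
    (max_degree E1 <= Delta)%N -> (max_degree E2 <= Delta)%N ->
    (5 + 948%:R / 1000%:R) * Delta%:R <= k%:R :> R ->
    (forall e, #|` L e| = k) ->
    (forall e c, c \in L e -> (0 < c)%N) ->
    exists P : nat -> R,
      local_flip_probabilities 6 P /\
      (mixing_time (flip_dynamics L k P) (proper_colorings L)
        <= (C * #|E1 :|: E2|%:R * ln n%:R)%:E)%E.
Proof.
(* 12000 is 2000 times the 6 in [ln9]; the other 2 absorbs the step lost to rounding, as [m * ln n]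
   is at least 1/2. *)
exists 12002 => n Delta V E1 E2 k L n1 D1 Vn simple1 simple2 deg1 deg2 kD Lk _.
exists (rate R); split; first exact: rate_local.
have k0 : (0 < k)%N.
  rewrite -(ltr0n R); apply: lt_le_trans kD; apply: mulr_gt0; last by rewrite ltr0n.
  by clear; lra.
have mE : #|E1 :|: E2| = #|edge E1 E2| by rewrite card_sig.
have mix := mixing_time_le Lk simple1 simple2 deg1 deg2 k0 kD.
rewrite mE; have [m0|m0] := posnP #|edge E1 E2|.
  rewrite m0 mulr0 mul0r; apply: (mix 0%N).
  by rewrite m0 !mulr0; lra.
(* An edge has two vertices, so [ln n] is bounded away from 0. *)
have n2 : (1 < n)%N.
  have [e _] := card_gt0P m0; rewrite -Vn -(card_edge simple1 simple2 e).
  exact: max_card.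
have mn : (#|edge E1 E2| <= n ^ 2)%N by rewrite -Vn card_edges_le.
set m := #|edge E1 E2| in mix mn m0 *.
have m1 : 1 <= m%:R :> R by rewrite ler1n.
have ln_half : 1/2 <= ln n%:R :> R.
  by apply: le_trans (ln2_ge_half R) _; rewrite ler_ln ?posrE ?ltr0n ?ler_nat.
(* For [n >= 2], [9 * m] is at most [2 ^ 4 * n ^ 2], hence at most [n ^ 6]. *)
have ln9 : ln (9 * m%:R) <= 6 * ln n%:R :> R.
  have n0 : 0 < n%:R :> R by rewrite ltr0n.
  have -> : 6 * ln n%:R = ln (n%:R ^+ 6) :> R by rewrite lnXn // mulr_natl.
  rewrite ler_ln ?posrE ?exprn_gt0 ?mulr_gt0 ?ltr0n //.
  rewrite -natrX -natrM ler_nat (@leq_trans (2 ^ 4 * n ^ 2)) //; first exact: leq_mul.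
  by rewrite (expnD n 4 2) leq_mul // leq_exp2r.
pose X := 2000 * m%:R * ln (9 * m%:R) : R.
have X0 : 0 <= X.
  by apply: mulr_ge0; [lra|apply: ln_ge0; lra].
have /andP[tX Xt] := truncn_itv X0.
apply: le_trans (mix (Num.truncn X).+1 _) _.
  exact: contraction_exp m0 (ltW Xt).
rewrite lee_fin -natr1; apply: le_trans (lerD tX (lexx _)) _.
have : m%:R * ln (9 * m%:R) <= m%:R * (6 * ln n%:R) :> R by rewrite ler_wpM2l.
have : 1/2 <= m%:R * ln n%:R :> R.
  by apply: (le_trans ln_half); rewrite ler_peMl //; lra.
rewrite /X; lra.
Qed.
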